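(* Fix $\theta\in[0,2\pi)$ and let $u_{\alpha,J}:\mathbb{R}^2\to S^5(1)$, $(\alpha,J)\in[0,1]\times[0,\tfrac1{3\sqrt3}]$, be the family of $\theta$-special Legendrian immersions defined in the context. (i) For every $\alpha\in\mathbb{Q}\cap(0,1]$, the immersion $u_{\alpha,0}$ is doubly periodic (with respect to some lattice in $\mathbb{R}^2$) and hence gives rise to a minimal Legendrian torus in $S^5(1)$. (ii) For a dense set of $J\in(0,\tfrac1{3\sqrt3})$ the immersion $u_{0,J}$ (i.e. $\alpha=0$) is doubly periodic and hence gives rise to a minimal Legendrian torus in $S^5(1)$.
   Context: $S^5(1)$ is the unit sphere in $\mathbb{C}^3$; a surface in it is Legendrian if the contact form $\iota_X\omega|_{S^5}$ vanishes on it ($X$ the Euler vector field, $\omega$ the standard symplectic form). Definition of $u_{\alpha,J}$. For $\alpha\in[0,1]$ put $A=i\,\mathrm{diag}(1,\alpha,-1-\alpha)$, $\mu=(\mu_1,\mu_2,\mu_3)=(-1-2\alpha,\,2+\alpha,\,\alpha-1)$ and $Q(x)=\prod_{j=1}^3(\tfrac13+\mu_jx)$. Case $J\in(0,\tfrac1{3\sqrt3}]$: let $\gamma_+$ be the smallest nonnegative root of $Q(x)=J^2$, and let $\gamma:\mathbb{R}\to\mathbb{R}$ be the solution of $\ddot\gamma=2Q'(\gamma)$, $\gamma(0)=\gamma_+$, $\dot\gamma(0)=0$ (so that $\dot\gamma^2/4+J^2=Q(\gamma)$). Put $R_j=\sqrt{\tfrac13+\mu_j\gamma}>0$, and let $\theta_j$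 satisfy $\dot\theta_j=J\mu_j/R_j^2$ with $\theta_1(0)=-\theta$, $\theta_2(0)=\theta_3(0)=0$. Set $z_j=R_je^{i\theta_j}$ and $u_{\alpha,J}(s,t)=e^{As}(z_1(t),z_2(t),z_3(t))$. Case $J=0$: with $r=\sqrt{1+2\alpha}$, $k^2=\frac{1-\alpha^2}{1+2\alpha}$ and Jacobi elliptic functions $\mathrm{sn},\mathrm{cn},\mathrm{dn}$ of modulus $k$, put $R_1=\sqrt{\tfrac{1+\alpha}{2+\alpha}}\,\mathrm{cn}(rt,k)$, $R_2=\sqrt{\tfrac{1+\alpha}{1+2\alpha}}\,\mathrm{sn}(rt,k)$, $R_3=\sqrt{\tfrac{1}{2+\alpha}}\,\mathrm{dn}(rt,k)$, and $u_{\alpha,0}(s,t)=e^{As}(e^{-i(\theta+\pi/2)}R_1(t),R_2(t),R_3(t))$. These are $\theta$-special Legendrian immersions: for a suitable orientation of $\mathbb{R}^2$, the pullback of $\iota_X\operatorname{Re}(e^{i\theta}dz^1\wedge dz^2\wedge dz^3)$ is the induced volume form; in particular they are minimal and Legendrian. *)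

(* Defs.v *)
(* Stdlib reals with Coquelicot. *)
From Stdlib Require Import Reals ClassicalEpsilon.
From Coquelicot Require Import Coquelicot.
Local Open Scope R_scope.

(** * The ambient space C^3 *)

Inductive idx : Set := i1 | i2 | i3.

Definition C3 : Type := idx -> C.

Definition sum3 (f : idx -> R) : R := f i1 + f i2 + f i3.

(** Euclidean inner product of C^3 = R^6. *)
Definition inner (v w : C3) : R :=
  sum3 (fun j => Re (v j) * Re (w j) + Im (v j) * Im (w j)).

(** omega = sum_j dx_j /\ dy_j, where z_j = x_j + i y_j. *)
Definition omega (v w : C3) : R :=
  sum3 (fun j => Re (v j) * Im (w j) - Im (v j) * Re (w j)).

Definition vzero : C3 := fun _ => RtoC 0.
Definition vadd (v w : C3) : C3 := fun j => Cplus (v j) (w j).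
Definition vscal (a : R) (v : C3) : C3 := fun j => Cmult (RtoC a) (v j).
Definition vsub (v w : C3) : C3 := vadd v (vscal (-1) w).

Definition in_S5 (v : C3) : Prop := inner v v = 1.

(** * Surfaces R^2 -> S^5 *)

Definition smooth (f : R -> R -> C3) : Prop :=
  forall (j : idx) (n : nat) (s t : R),
    ex_diff_n (fun x y => Re (f x y j)) n s t /\
    ex_diff_n (fun x y => Im (f x y j)) n s t.

Definition d_s (f : R -> R -> C3) : R -> R -> C3 := fun s t j =>
  (Derive (fun x => Re (f x t j)) s, Derive (fun x => Im (f x t j)) s).

Definition d_t (f : R -> R -> C3) : R -> R -> C3 := fun s t j =>
  (Derive (fun y => Re (f s y j)) t, Derive (fun y => Im (f s y j)) t).

(** The differential of [f] at [(s, t)], applied to [(a, b)]. *)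
Definition differential (f : R -> R -> C3) (s t a b : R) : C3 :=
  vadd (vscal a (d_s f s t)) (vscal b (d_t f s t)).

Definition immersion_S5 (f : R -> R -> C3) : Prop :=
  smooth f /\
  (forall s t, in_S5 (f s t)) /\
  (forall s t a b, differential f s t a b = vzero -> a = 0 /\ b = 0).

(** The Euler field X takes the value p at the point p, so that the contact
    form iota_X omega sends a vector v tangent at p to omega(p, v). *)
Definition legendrian (f : R -> R -> C3) : Prop :=
  forall s t a b, omega (f s t) (differential f s t a b) = 0.

Definition g11 (f : R -> R -> C3) (s t : R) : R := inner (d_s f s t) (d_s f s t).
Definition g12 (f : R -> R -> C3) (s t : R) : R := inner (d_s f s t) (d_t f s t).
Definition g22 (f : R -> R -> C3) (s t : R) : R := inner (d_t f s t) (d_t f s t).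
Definition detg (f : R -> R -> C3) (s t : R) : R :=
  g11 f s t * g22 f s t - g12 f s t ^ 2.

(** Orthogonal projection of C^3 onto the tangent plane of the surface at
    f(s, t): sum over i, k of g^{ik} <v, d_i f> d_k f. *)
Definition tangent_part (f : R -> R -> C3) (s t : R) (v : C3) : C3 :=
  let fs := d_s f s t in
  let ft := d_t f s t in
  vadd
    (vscal ((g22 f s t * inner v fs - g12 f s t * inner v ft) / detg f s t) fs)
    (vscal ((g11 f s t * inner v ft - g12 f s t * inner v fs) / detg f s t) ft).

(** Orthogonal projection of C^3 onto the normal space, at f(s, t), of the
    surface inside S^5; the unit normal of S^5 at f(s, t) is f(s, t). *)
Definition normal_part (f : R -> R -> C3) (s t : R) (v : C3) : C3 :=
  vsub (vsub v (vscal (inner v (f s t)) (f s t))) (tangent_part f s t v).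

(** Components of the second fundamental form of the surface in S^5. *)
Definition II11 (f : R -> R -> C3) (s t : R) : C3 :=
  normal_part f s t (d_s (d_s f) s t).
Definition II12 (f : R -> R -> C3) (s t : R) : C3 :=
  normal_part f s t (d_s (d_t f) s t).
Definition II22 (f : R -> R -> C3) (s t : R) : C3 :=
  normal_part f s t (d_t (d_t f) s t).

(** Half the trace of the second fundamental form with respect to the induced
    metric. *)
Definition mean_curvature (f : R -> R -> C3) (s t : R) : C3 :=
  vscal (/ (2 * detg f s t))
    (vadd (vsub (vscal (g22 f s t) (II11 f s t))
                (vscal (2 * g12 f s t) (II12 f s t)))
          (vscal (g11 f s t) (II22 f s t))).

Definition minimal (f : R -> R -> C3) : Prop :=
  forall s t, mean_curvature f s t = vzero.

Definition minimal_legendrian_immersion (f : R -> R -> C3) : Prop :=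
  immersion_S5 f /\ legendrian f /\ minimal f.

(** * Lattices and tori *)

Definition is_lattice (L : R -> R -> Prop) : Prop :=
  exists v1 v2 w1 w2 : R,
    v1 * w2 - v2 * w1 <> 0 /\
    forall x y, L x y <->
      exists m n : Z, x = IZR m * v1 + IZR n * w1 /\ y = IZR m * v2 + IZR n * w2.

Definition doubly_periodic (L : R -> R -> Prop) (f : R -> R -> C3) : Prop :=
  is_lattice L /\ forall x y, L x y -> forall s t, f (s + x) (t + y) = f s t.

Definition coset (L : R -> R -> Prop) (s t : R) : R -> R -> Prop :=
  fun x y => L (x - s) (y - t).

(** The quotient R^2 / L, as the set of cosets of L. *)
Definition torus (L : R -> R -> Prop) : Type :=
  {c : R -> R -> Prop | exists s t, c = coset L s t}.

Definition proj (L : R -> R -> Prop) (s t : R) : torus L :=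
  exist _ (coset L s t) (ex_intro _ s (ex_intro _ t eq_refl)).

(** The projection R^2 -> R^2 / L is the local diffeomorphism defining the
    smooth structure of the torus, and being a minimal Legendrian immersion is a
    local property, so it is read off on the lift to R^2. *)
Definition minimal_legendrian_torus (L : R -> R -> Prop) (F : torus L -> C3)
  : Prop :=
  is_lattice L /\ minimal_legendrian_immersion (fun s t => F (proj L s t)).

(** * Jacobi elliptic functions of modulus k, for 0 <= k <= 1 *)

(** The amplitude of x is the phi with
    x = int_0^phi dtau / sqrt (1 - k^2 sin^2 tau).  For k = 1 the integrand is
    unbounded, hence not Riemann integrable, as soon as |phi| >= PI/2; the phi
    selected is then the one in (-PI/2, PI/2), the Gudermannian of x. *)
Definition am (x k : R) : R :=
  epsilon (inhabits 0)
    (fun phi => is_RInt (fun tau => / sqrt (1 - k ^ 2 * sin tau ^ 2)) 0 phi x).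

Definition sn (x k : R) : R := sin (am x k).
Definition cn (x k : R) : R := cos (am x k).
Definition dn (x k : R) : R := sqrt (1 - k ^ 2 * sn x k ^ 2).

(** * The family u_{alpha,J} *)

Definition cis (x : R) : C := (cos x, sin x).

(** A = i diag(eig i1, eig i2, eig i3), so e^{As} is diagonal with entries
    e^{i eig s}. *)
Definition eig (alpha : R) (j : idx) : R :=
  match j with i1 => 1 | i2 => alpha | i3 => - 1 - alpha end.

Definition exp_A (alpha s : R) (v : C3) : C3 :=
  fun j => Cmult (cis (eig alpha j * s)) (v j).

Definition mu (alpha : R) (j : idx) : R :=
  match j with
  | i1 => - 1 - 2 * alpha
  | i2 => 2 + alpha
  | i3 => alpha - 1
  end.

Definition Qcubic (alpha x : R) : R :=
  (1 / 3 + mu alpha i1 * x) * (1 / 3 + mu alpha i2 * x) * (1 / 3 + mu alpha i3 * x).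

Definition is_gamma_plus (alpha J x : R) : Prop :=
  0 <= x /\ Qcubic alpha x = J ^ 2 /\
  forall y, 0 <= y -> Qcubic alpha y = J ^ 2 -> x <= y.

Definition is_gamma (alpha J : R) (g : R -> R) : Prop :=
  is_gamma_plus alpha J (g 0) /\
  is_derive g 0 0 /\
  forall t, ex_derive g t /\
            is_derive (Derive g) t (2 * Derive (Qcubic alpha) (g t)).

(** The solution of the initial value problem [is_gamma]; it exists and is
    unique for alpha in [0, 1] and J in (0, 1 / (3 sqrt 3)]. *)
Definition gamma (alpha J : R) : R -> R :=
  epsilon (inhabits (fun _ => 0)) (is_gamma alpha J).

Definition Rad (alpha J : R) (j : idx) (t : R) : R :=
  sqrt (1 / 3 + mu alpha j * gamma alpha J t).

(** theta_j is the primitive of J mu_j / R_j^2 with the prescribed theta_j(0). *)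
Definition angle (theta alpha J : R) (j : idx) (t : R) : R :=
  match j with i1 => - theta | i2 => 0 | i3 => 0 end
  + RInt (fun x => J * mu alpha j / Rad alpha J j x ^ 2) 0 t.

Definition zJ (theta alpha J t : R) : C3 := fun j =>
  Cmult (RtoC (Rad alpha J j t)) (cis (angle theta alpha J j t)).

Definition Rad0 (alpha : R) (j : idx) (t : R) : R :=
  let r := sqrt (1 + 2 * alpha) in
  let k := sqrt ((1 - alpha ^ 2) / (1 + 2 * alpha)) in
  match j with
  | i1 => sqrt ((1 + alpha) / (2 + alpha)) * cn (r * t) k
  | i2 => sqrt ((1 + alpha) / (1 + 2 * alpha)) * sn (r * t) k
  | i3 => sqrt (1 / (2 + alpha)) * dn (r * t) k
  end.

Definition z0 (theta alpha t : R) : C3 := fun j =>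
  match j with
  | i1 => Cmult (cis (- (theta + PI / 2))) (RtoC (Rad0 alpha i1 t))
  | i2 => RtoC (Rad0 alpha i2 t)
  | i3 => RtoC (Rad0 alpha i3 t)
  end.

Definition u (theta alpha J : R) : R -> R -> C3 := fun s t =>
  exp_A alpha s
    (if Req_EM_T J 0 then z0 theta alpha t else zJ theta alpha J t).

Definition dense_in (D : R -> Prop) (lo hi : R) : Prop :=
  (forall x, D x -> lo < x < hi) /\
  forall x, lo < x < hi -> forall eps, 0 < eps -> exists y, D y /\ Rabs (y - x) < eps.

(* Main.v *)
Require Import Defs.
From Stdlib Require Import Reals ZArith QArith Qreals Lra Lia ClassicalEpsilon FunctionalExtensionality.
From Coquelicot Require Import Coquelicot.
Local Open Scope R_scope.

(** Both families have the form [f s t = e^{As} z t] with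
    [z_j' = mu_j w conj (z_k z_l)] for a constant unit [w] and cyclic [(j, k, l)];
    since [mu_j = eig l - eig k], the parametrisation is conformal, Legendrian, and
    satisfies [f_ss + f_tt = - 2 |f_s|^2 f], so it is minimal.  For [J = 0] the curve
    [z] is periodic in [t], and [s] has a period when [alpha] is rational.
    For [alpha = 0] and [J > 0], [gamma] is solved explicitly in terms of an angle; over
    one period of [gamma] the angle [theta_2] grows by
    [rotation m = 2 / sqrt 3 * int_0^PI cos (atan (m sin x) / 3) dx], where
    [27 J^2 (1 + m^2) = 1], and [theta_1], [theta_3] change by [- rotation m / 2].
    The surface closes up as soon as [rotation m / (2 PI)] is rational, which happens for
    a dense set of [J] because [rotation] is continuous and strictly decreasing. *)

(** * Inverting a primitive of a positive function *)

(** Both [am] and [gamma] are values of [epsilon]: nothing is known of them until a solution is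
    exhibited, and [gamma] also needs a uniqueness theorem before it can be replaced by the
    exhibited one. The usual quadrature for [gamma] is singular where its derivative vanishes and
    would have to be glued at every turning point. The angular variable [x] avoids this: time is a
    primitive in [x] with density at least [J], so one global inverse covers all oscillations, and
    the same inversion result yields [am]. The substitution [4/3 sin^2 beta] is the trigonometric
    solution of a cubic with three real roots; it also brings the rotation integral to a form whose
    monotonicity can be read off the integrand. The unit [w] is kept arbitrary because it is
    [- i e^{-i theta}] for [J = 0] and [i e^{-i theta}] for [J > 0], the sign reflecting the
    direction of [t]. *)

Lemma primitive_growth (G P : R -> R) (c : R)
  (HG : forall x, is_derive G x (P x)) (HP : forall x, c <= P x) (x y : R) :
  x <= y -> c * (y - x) <= G y - G x.
Proof.
  intros Hxy.
  destruct (MVT_gen G x y P) as [z [_ Hz]].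
  - intros; apply HG.
  - intros w _. apply derivable_continuous_pt.
    exists (P w). apply is_derive_Reals, HG.
  - rewrite Hz. apply Rmult_le_compat_r; [lra | apply HP].
Qed.

Lemma primitive_growth_abs (G P : R -> R) (c : R)
  (HG : forall x, is_derive G x (P x)) (HP : forall x, c <= P x) (x y : R) :
  c * Rabs (y - x) <= Rabs (G y - G x).
Proof.
  destruct (Rle_or_lt x y) as [H | H].
  - generalize (primitive_growth G P c HG HP x y H) (Rle_abs (G y - G x)).
    rewrite (Rabs_right (y - x)); lra.
  - generalize (primitive_growth G P c HG HP y x (Rlt_le _ _ H)) (Rle_abs (G x - G y)).
    rewrite (Rabs_left (y - x)), (Rabs_minus_sym (G y)); lra.
Qed.

Lemma primitive_injective (G P : R -> R) (c : R) (Hc : 0 < c)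
  (HG : forall x, is_derive G x (P x)) (HP : forall x, c <= P x) (x y : R) :
  G x = G y -> x = y.
Proof.
  intros H. generalize (primitive_growth_abs G P c HG HP y x).
  rewrite H, Rminus_diag, Rabs_R0. intros H1.
  destruct (Req_dec x y) as [| Hn]; [assumption | exfalso].
  assert (0 < Rabs (x - y)) by (apply Rabs_pos_lt; lra). nra.
Qed.

Lemma primitive_surjective (G P : R -> R) (c : R) (Hc : 0 < c)
  (HG : forall x, is_derive G x (P x)) (HP : forall x, c <= P x) (t : R) :
  exists x, G x = t.
Proof.
  (* With slope at least [c], moving by [d] to either side of 0 changes [G] by at least the distance
     from [G 0] to [t]. *)
  set (d := Rabs (t - G 0) / c).
  assert (Hd : 0 <= d).
  { apply Rmult_le_pos; [apply Rabs_pos | left; apply Rinv_0_lt_compat, Hc]. }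
  assert (Hcd : c * d = Rabs (t - G 0)) by (unfold d; field; lra).
  destruct (IVT_gen G (- d) d t) as [x [_ Hx]].
  - intros w. apply derivable_continuous_pt.
    exists (P w). apply is_derive_Reals, HG.
  - assert (Hd' : - d <= 0) by lra.
    generalize (primitive_growth G P c HG HP 0 d Hd)
      (primitive_growth G P c HG HP (- d) 0 Hd')
      (Rle_abs (t - G 0)) (Rle_abs (- (t - G 0))).
    rewrite Rabs_Ropp. intros. rewrite Rmin_left, Rmax_right; lra.
  - exists x; exact Hx.
Qed.

(** The difference quotient of [psi] is the reciprocal of one of [G]. The growth bound makes [psi]
    Lipschitz with constant [1 / c], which controls the increment [k] of [psi] without a separate
    continuity argument. *)
Lemma primitive_inverse_derive (G P psi : R -> R) (c : R) (Hc : 0 < c)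
  (HG : forall x, is_derive G x (P x)) (HP : forall x, c <= P x)
  (Hpsi : forall t, G (psi t) = t) (t : R) :
  is_derive psi t (/ P (psi t)).
Proof.
  assert (HP0 : 0 < P (psi t)) by (generalize (HP (psi t)); lra).
  assert (Hlip : forall s, c * Rabs (psi s - psi t) <= Rabs (s - t)).
  { intros s. generalize (primitive_growth_abs G P c HG HP (psi t) (psi s)).
    rewrite !Hpsi. trivial. }
  apply is_derive_Reals.
  intros eps Heps.
  (* The error of [h / k] is that of [k / h] times [P (psi t) * (h / k)], and [h / k] is at least
     [c] in absolute value; this fixes the tolerance. *)
  destruct (proj1 (is_derive_Reals _ _ _) (HG (psi t)) (eps * c * P (psi t)))
    as [del Hdel].
  { apply Rmult_lt_0_compat; [apply Rmult_lt_0_compat |]; assumption. }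
  assert (Hcd : 0 < c * del) by (apply Rmult_lt_0_compat; [assumption | apply cond_pos]).
  exists (mkposreal _ Hcd). simpl. intros h Hh Hhd.
  set (k := psi (t + h) - psi t).
  assert (Hk : c * Rabs k <= Rabs h).
  { generalize (Hlip (t + h)). replace (t + h - t) with h by ring. trivial. }
  assert (Gk : G (psi t + k) = t + h).
  { unfold k. replace (psi t + (psi (t + h) - psi t)) with (psi (t + h)) by ring.
    apply Hpsi. }
  assert (Hk0 : k <> 0).
  { intros H0. rewrite H0, Rplus_0_r, Hpsi in Gk. lra. }
  assert (Hkd : Rabs k < del).
  { apply Rmult_lt_reg_l with c; [assumption | lra]. }
  generalize (Hdel k Hk0 Hkd). rewrite Gk, Hpsi.
  replace ((t + h - t) / k - P (psi t))
    with (- (k / h - / P (psi t)) * (P (psi t) * (h / k))) by (field; repeat split; lra).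
  rewrite !Rabs_mult, Rabs_Ropp, (Rabs_right (P (psi t))) by lra.
  intros H.
  assert (Hhk : c <= Rabs (h / k)).
  { unfold Rdiv. rewrite Rabs_mult, Rabs_inv.
    assert (0 < Rabs k) by (apply Rabs_pos_lt, Hk0).
    apply Rmult_le_reg_r with (Rabs k); [assumption |].
    rewrite Rmult_assoc, Rinv_l; lra. }
  apply Rmult_lt_reg_r with (P (psi t) * c); [nra |].
  eapply Rle_lt_trans; [| apply Rlt_le_trans with (1 := H); lra].
  apply Rmult_le_compat_l; [apply Rabs_pos | nra].
Qed.

Lemma primitive_inverse_shift (G P psi : R -> R) (c p T : R) (Hc : 0 < c)
  (HG : forall x, is_derive G x (P x)) (HP : forall x, c <= P x)
  (Hpsi : forall t, G (psi t) = t) (HT : forall x, G (x + p) = G x + T) (t : R) :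
  psi (t + T) = psi t + p.
Proof.
  apply (primitive_injective G P c Hc HG HP).
  rewrite HT, !Hpsi. reflexivity.
Qed.

Lemma continuous_is_derive_RInt (f : R -> R) (a x : R) :
  (forall y, continuous f y) -> is_derive (fun b => RInt f a b) x (f x).
Proof.
  intros Hf. apply is_derive_RInt with a.
  - apply filter_forall. intros b. apply (RInt_correct (V := R_CompleteNormedModule)).
    apply (ex_RInt_continuous (V := R_CompleteNormedModule)). intros; apply Hf.
  - apply Hf.
Qed.

Lemma is_derive_continuous (f : R -> R) (x l : R) :
  is_derive f x l -> continuous f x.
Proof.
  intros H. apply (ex_derive_continuous (V := R_NormedModule)). exists l; exact H.
Qed.

Lemma is_derive_0_const (f : R -> R) :
  (forall x, is_derive f x 0) -> forall x y, f x = f y.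
Proof.
  intros H.
  assert (Hlt : forall x y, x < y -> f x = f y).
  { intros x y Hxy. apply (eq_is_derive (V := R_NormedModule)); [| exact Hxy].
    intros; apply H. }
  intros x y. destruct (Rtotal_order x y) as [h | [h | h]].
  - apply Hlt, h.
  - rewrite h; reflexivity.
  - symmetry; apply Hlt, h.
Qed.

Lemma is_derive_eq_const (f g df : R -> R) (a : R) :
  (forall x, is_derive f x (df x)) -> (forall x, is_derive g x (df x)) ->
  f a = g a -> forall x, f x = g x.
Proof.
  intros Hf Hg Ha x.
  assert (H := is_derive_0_const (fun y => f y - g y)).
  enough (f x - g x = f a - g a) by lra.
  apply H. intros y. replace 0 with (minus (df y) (df y)) by (apply Rminus_diag).
  apply (is_derive_minus (V := R_NormedModule)); [apply Hf | apply Hg].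
Qed.

(* Periodicity of the integrand makes [G (x + p) - G x] constant. *)
Lemma primitive_shift (G P : R -> R) (p a : R) :
  (forall x, is_derive G x (P x)) -> (forall x, P (x + p) = P x) ->
  forall x, G (x + p) = G x + (G (a + p) - G a).
Proof.
  intros HG Hp x.
  apply (is_derive_eq_const (fun x => G (x + p))
    (fun x => G x + (G (a + p) - G a)) P a).
  - intros y. rewrite <- Hp.
    evar_last. apply (is_derive_comp G (fun y => y + p)).
    apply HG. auto_derive; [trivial | reflexivity]. apply Rmult_1_l.
  - intros y. evar_last. apply (is_derive_plus (V := R_NormedModule)).
    apply HG. apply (is_derive_const (V := R_NormedModule)).
    apply Rplus_0_r.
  - ring.
Qed.

(** * Surfaces solving the special Legendrian equations *)

(** The first-order system expresses both partial derivatives of a coordinate as polynomials in the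
    coordinates. This algebra is therefore closed under differentiation, and smoothness follows by
    induction on the order with no formula for higher derivatives. *)
Inductive poly_in (f : R -> R -> C3) : (R -> R -> R) -> Prop :=
| poly_const c : poly_in f (fun _ _ => c)
| poly_Re j : poly_in f (fun s t => Re (f s t j))
| poly_Im j : poly_in f (fun s t => Im (f s t j))
| poly_plus g h : poly_in f g -> poly_in f h -> poly_in f (fun s t => g s t + h s t)
| poly_mult g h : poly_in f g -> poly_in f h -> poly_in f (fun s t => g s t * h s t).

Lemma poly_opp (f : R -> R -> C3) (g : R -> R -> R) :
  poly_in f g -> poly_in f (fun s t => - g s t).
Proof.
  intros Hg. replace (fun s t => - g s t) with (fun s t => -1 * g s t).
  - apply (poly_mult f (fun _ _ => -1)); [apply poly_const | exact Hg].
  - apply functional_extensionality; intros s.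
    apply functional_extensionality; intros t. ring.
Qed.

Lemma poly_minus (f : R -> R -> C3) (g h : R -> R -> R) :
  poly_in f g -> poly_in f h -> poly_in f (fun s t => g s t - h s t).
Proof.
  intros Hg Hh. apply (poly_plus f g (fun s t => - h s t)); [exact Hg |].
  apply poly_opp, Hh.
Qed.

Definition next (j : idx) : idx := match j with i1 => i2 | i2 => i3 | i3 => i1 end.

Definition ds_field (alpha : R) (v : C3) : C3 := fun j =>
  (- (eig alpha j * Im (v j)), eig alpha j * Re (v j)).

(* A unimodular multiple of the conjugate of the complex cross product of [v] and
   [A v], because [mu j = eig (next (next j)) - eig (next j)]. *)
Definition dt_field (alpha : R) (w : C) (v : C3) : C3 := fun j =>
  let a := v (next j) in
  let b := v (next (next j)) in
  (mu alpha j * (Re w * (Re a * Re b - Im a * Im b) + Im w * (Re a * Im b + Im a * Re b)),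
   mu alpha j * (Im w * (Re a * Re b - Im a * Im b) - Re w * (Re a * Im b + Im a * Re b))).

Definition sqmod (v : C3) (j : idx) : R := Re (v j) ^ 2 + Im (v j) ^ 2.

(** In order: [v] lies on the sphere, [A v] is annihilated by the contact form, and [A v] is
    nonzero, which gives the immersion property. *)
Definition admissible (alpha : R) (v : C3) : Prop :=
  sum3 (sqmod v) = 1 /\
  sum3 (fun j => eig alpha j * sqmod v j) = 0 /\
  0 < sum3 (fun j => eig alpha j ^ 2 * sqmod v j).

(** Joint continuity is listed beside the partial derivatives because [ex_diff_n] asks for it at
    every order. *)
Definition special_surface (alpha : R) (w : C) (f : R -> R -> C3) : Prop :=
  Re w ^ 2 + Im w ^ 2 = 1 /\
  (forall j s t,
     continuity_2d_pt (fun x y => Re (f x y j)) s t /\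
     continuity_2d_pt (fun x y => Im (f x y j)) s t /\
     is_derive (fun x => Re (f x t j)) s (Re (ds_field alpha (f s t) j)) /\
     is_derive (fun x => Im (f x t j)) s (Im (ds_field alpha (f s t) j)) /\
     is_derive (fun y => Re (f s y j)) t (Re (dt_field alpha w (f s t) j)) /\
     is_derive (fun y => Im (f s y j)) t (Im (dt_field alpha w (f s t) j))) /\
  forall s t, admissible alpha (f s t).

Lemma poly_derive (alpha : R) (w : C) (f : R -> R -> C3)
  (Hf : special_surface alpha w f) (g : R -> R -> R) :
  poly_in f g ->
  (forall s t, continuity_2d_pt g s t) /\
  (exists gs, poly_in f gs /\ forall s t, is_derive (fun x => g x t) s (gs s t)) /\
  (exists gt, poly_in f gt /\ forall s t, is_derive (fun y => g s y) t (gt s t)).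
Proof.
  destruct Hf as [_ [Hf _]].
  induction 1 as [c | j | j | g h _ [IHg [[gs [Hgs Dgs]] [gt [Hgt Dgt]]]]
    _ [IHh [[hs [Hhs Dhs]] [ht [Hht Dht]]]]
    | g h Pg [IHg [[gs [Hgs Dgs]] [gt [Hgt Dgt]]]]
    Ph [IHh [[hs [Hhs Dhs]] [ht [Hht Dht]]]]].
  - split; [intros; apply continuity_2d_pt_const |].
    split; exists (fun _ _ => 0); (split; [apply poly_const |]); intros;
      apply (is_derive_const (V := R_NormedModule)).
  - split; [intros; apply Hf |].
    split; [exists (fun s t => Re (ds_field alpha (f s t) j))
      | exists (fun s t => Re (dt_field alpha w (f s t) j))];
      (split; [| intros; apply Hf]); simpl;
      repeat first [apply poly_opp | apply poly_minus | apply poly_plus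
        | apply poly_mult | apply poly_const | apply poly_Re | apply poly_Im].
  - split; [intros; apply Hf |].
    split; [exists (fun s t => Im (ds_field alpha (f s t) j))
      | exists (fun s t => Im (dt_field alpha w (f s t) j))];
      (split; [| intros; apply Hf]); simpl;
      repeat first [apply poly_opp | apply poly_minus | apply poly_plus
        | apply poly_mult | apply poly_const | apply poly_Re | apply poly_Im].
  - split; [intros; apply continuity_2d_pt_plus; auto |].
    split; [exists (fun s t => gs s t + hs s t) | exists (fun s t => gt s t + ht s t)];
      (split; [apply poly_plus; assumption |]); intros;
      apply (is_derive_plus (V := R_NormedModule)); auto.
  - split; [intros; apply continuity_2d_pt_mult; auto |].
    split; [exists (fun s t => gs s t * h s t + g s t * hs s t)
      | exists (fun s t => gt s t * h s t + g s t * ht s t)];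
      (split; [apply poly_plus; apply poly_mult; assumption |]); intros s t.
    + apply (is_derive_mult (fun x => g x t) (fun x => h x t)); auto.
      intros; apply Rmult_comm.
    + apply (is_derive_mult (fun y => g s y) (fun y => h s y)); auto.
      intros; apply Rmult_comm.
Qed.

Lemma poly_smooth (alpha : R) (w : C) (f : R -> R -> C3)
  (Hf : special_surface alpha w f) (n : nat) :
  forall g s t, poly_in f g -> ex_diff_n g n s t.
Proof.
  induction n as [| n IH]; intros g s t Hg;
    destruct (poly_derive alpha w f Hf g Hg)
      as [Hc [[gs [Hgs Dgs]] [gt [Hgt Dgt]]]].
  - split; [apply Hc | exact I].
  - split; [apply Hc |].
    split; [exists (gs s t); apply Dgs |].
    split; [exists (gt s t); apply Dgt |].
    split.
    + replace (fun u v => Derive (fun z => g z v) u) with gs; [apply IH, Hgs |].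
      apply functional_extensionality; intros x.
      apply functional_extensionality; intros y.
      symmetry. apply is_derive_unique, Dgs.
    + replace (fun u v => Derive (fun z => g u z) v) with gt; [apply IH, Hgt |].
      apply functional_extensionality; intros x.
      apply functional_extensionality; intros y.
      symmetry. apply is_derive_unique, Dgt.
Qed.

Lemma C3_ext (v w : C3) :
  (forall j, Re (v j) = Re (w j)) -> (forall j, Im (v j) = Im (w j)) -> v = w.
Proof.
  intros H1 H2. apply functional_extensionality; intros j.
  generalize (H1 j) (H2 j). destruct (v j), (w j). simpl. intros -> ->. reflexivity.
Qed.

Lemma special_d_s (alpha : R) (w : C) (f : R -> R -> C3)
  (Hf : special_surface alpha w f) : d_s f = fun s t => ds_field alpha (f s t).
Proof.
  destruct Hf as [_ [Hf _]].
  apply functional_extensionality; intros s.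
  apply functional_extensionality; intros t.
  apply C3_ext; intros j; apply is_derive_unique, Hf.
Qed.

Lemma special_d_t (alpha : R) (w : C) (f : R -> R -> C3)
  (Hf : special_surface alpha w f) : d_t f = fun s t => dt_field alpha w (f s t).
Proof.
  destruct Hf as [_ [Hf _]].
  apply functional_extensionality; intros s.
  apply functional_extensionality; intros t.
  apply C3_ext; intros j; apply is_derive_unique, Hf.
Qed.

Lemma special_d_ss (alpha : R) (w : C) (f : R -> R -> C3)
  (Hf : special_surface alpha w f) (s t : R) :
  d_s (d_s f) s t = fun j => Cmult (RtoC (- eig alpha j ^ 2)) (f s t j).
Proof.
  rewrite (special_d_s alpha w f Hf).
  destruct Hf as [_ [Hf _]].
  apply C3_ext; intros j; apply is_derive_unique; simpl;
    destruct (Hf j s t) as [_ [_ [HR [HI _]]]]; simpl in HR, HI.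
  - evar_last. apply (is_derive_opp (V := R_NormedModule)).
    apply (is_derive_scal (fun x => Im (f x t j))). exact HI.
    unfold opp; simpl. unfold Re, Im. ring.
  - evar_last. apply (is_derive_scal (fun x => Re (f x t j))). exact HR.
    unfold Re, Im. ring.
Qed.

Lemma is_derive_bilinear (a b c d : R -> R) (a' b' c' d' m p q t : R) :
  is_derive a t a' -> is_derive b t b' -> is_derive c t c' -> is_derive d t d' ->
  is_derive (fun y => m * (p * (a y * c y - b y * d y) + q * (a y * d y + b y * c y))) t
    (m * (p * (a' * c t + a t * c' - (b' * d t + b t * d'))
          + q * (a' * d t + a t * d' + (b' * c t + b t * c')))).
Proof.
  intros Ha Hb Hc Hd. auto_derive.
  - repeat split; eexists; eassumption.
  - replace (Derive (fun x => a x) t) with a' by (symmetry; apply is_derive_unique, Ha).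
    replace (Derive (fun x => b x) t) with b' by (symmetry; apply is_derive_unique, Hb).
    replace (Derive (fun x => c x) t) with c' by (symmetry; apply is_derive_unique, Hc).
    replace (Derive (fun x => d x) t) with d' by (symmetry; apply is_derive_unique, Hd).
    ring.
Qed.

(** Differentiating [z_j' = mu_j w conj (z_k z_l)] again produces
    [conj (z_k') = mu_k conj w z_l z_j]: the conjugations undo each other and [w] enters only
    through [|w|^2 = 1], so the result is a real multiple of [z_j]. *)
Lemma special_d_tt (alpha : R) (w : C) (f : R -> R -> C3)
  (Hf : special_surface alpha w f) (s t : R) :
  d_t (d_t f) s t = fun j =>
    Cmult (RtoC (mu alpha j *
      (mu alpha (next j) * sqmod (f s t) (next (next j)) +
       mu alpha (next (next j)) * sqmod (f s t) (next j)))) (f s t j).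
Proof.
  rewrite (special_d_t alpha w f Hf).
  destruct Hf as [Hw [Hf _]].
  assert (Hn : forall j, next (next (next j)) = j) by (intros []; reflexivity).
  apply C3_ext; intros j; apply is_derive_unique;
    destruct (Hf (next j) s t) as [_ [_ [_ [_ [HkR HkI]]]]];
    destruct (Hf (next (next j)) s t) as [_ [_ [_ [_ [HlR HlI]]]]];
    unfold dt_field in HkR, HkI, HlR, HlI; rewrite ?Hn in HkR, HkI, HlR, HlI.
  - evar_last.
    + exact (is_derive_bilinear _ _ _ _ _ _ _ _ (mu alpha j) (Re w) (Im w) t
        HkR HkI HlR HlI).
    + unfold sqmod. set (m := mu alpha j). set (n := mu alpha (next j)).
      set (o := mu alpha (next (next j))). clearbody m n o.
      destruct (f s t j) as [a b], (f s t (next j)) as [c d],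
        (f s t (next (next j))) as [e g], w as [p q]. simpl in *.
      transitivity ((p * (p * 1) + q * (q * 1)) * (m * (n * (e * (e * 1) + g * (g * 1))
        + o * (c * (c * 1) + d * (d * 1))) * a)); [| rewrite Hw]; ring.
  - evar_last.
    + apply is_derive_ext with (fun y => mu alpha j *
        (Im w * (Re (f s y (next j)) * Re (f s y (next (next j))) -
                 Im (f s y (next j)) * Im (f s y (next (next j)))) +
         (- Re w) * (Re (f s y (next j)) * Im (f s y (next (next j))) +
                 Im (f s y (next j)) * Re (f s y (next (next j)))))).
      { intros y. unfold dt_field; simpl. ring. }
      exact (is_derive_bilinear _ _ _ _ _ _ _ _ (mu alpha j) (Im w) (- Re w) t
        HkR HkI HlR HlI).
    + unfold sqmod. set (m := mu alpha j). set (n := mu alpha (next j)).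
      set (o := mu alpha (next (next j))). clearbody m n o.
      destruct (f s t j) as [a b], (f s t (next j)) as [c d],
        (f s t (next (next j))) as [e g], w as [p q]. simpl in *.
      transitivity ((p * (p * 1) + q * (q * 1)) * (m * (n * (e * (e * 1) + g * (g * 1))
        + o * (c * (c * 1) + d * (d * 1))) * b)); [| rewrite Hw]; ring.
Qed.

Definition energy (alpha : R) (v : C3) : R :=
  sum3 (fun j => eig alpha j ^ 2 * sqmod v j).

Lemma inner_ds_ds (alpha : R) (v : C3) :
  inner (ds_field alpha v) (ds_field alpha v) = energy alpha v.
Proof.
  unfold inner, energy, ds_field, sqmod, sum3; simpl. ring.
Qed.

(** Each summand is [eig j * mu j] times one and the same real number, built from
    [w conj (v_1 v_2 v_3)], and the cyclic sum of [eig j * (eig l - eig k)] vanishes. *)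
Lemma inner_ds_dt (alpha : R) (w : C) (v : C3) :
  inner (ds_field alpha v) (dt_field alpha w v) = 0.
Proof.
  unfold inner, dt_field, ds_field, sum3; simpl.
  destruct (v i1), (v i2), (v i3), w; simpl. ring.
Qed.

(* Lagrange's identity for the vectors with entries [|v_j|] and [eig j |v_j|]. *)
Lemma inner_dt_dt (alpha : R) (w : C) (v : C3) :
  Re w ^ 2 + Im w ^ 2 = 1 -> admissible alpha v ->
  inner (dt_field alpha w v) (dt_field alpha w v) = energy alpha v.
Proof.
  intros Hw [H1 [H2 _]].
  transitivity ((Re w ^ 2 + Im w ^ 2) * (sum3 (sqmod v) * energy alpha v
    - (sum3 (fun j => eig alpha j * sqmod v j)) ^ 2)).
  - unfold inner, dt_field, energy, sqmod, sum3; simpl.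
    destruct (v i1), (v i2), (v i3), w; simpl. ring.
  - rewrite Hw, H1, H2. ring.
Qed.

Lemma inner_self_ds (alpha : R) (v : C3) : inner v (ds_field alpha v) = 0.
Proof.
  unfold inner, ds_field, sum3; simpl.
  destruct (v i1), (v i2), (v i3); simpl. ring.
Qed.

(** The summands share a factor built from [w conj (v_1 v_2 v_3)], and the [mu j] add up to 0. The
    same reason makes [omega_self_dt] hold. *)
Lemma inner_self_dt (alpha : R) (w : C) (v : C3) : inner v (dt_field alpha w v) = 0.
Proof.
  unfold inner, dt_field, sum3; simpl.
  destruct (v i1), (v i2), (v i3), w; simpl. ring.
Qed.

Lemma omega_self_ds (alpha : R) (v : C3) :
  omega v (ds_field alpha v) = sum3 (fun j => eig alpha j * sqmod v j).
Proof.
  unfold omega, ds_field, sqmod, sum3; simpl.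
  destruct (v i1), (v i2), (v i3); simpl. ring.
Qed.

Lemma omega_self_dt (alpha : R) (w : C) (v : C3) : omega v (dt_field alpha w v) = 0.
Proof.
  unfold omega, dt_field, sum3; simpl.
  destruct (v i1), (v i2), (v i3), w; simpl. ring.
Qed.

Lemma inner_vadd_l (a b c : C3) : inner (vadd a b) c = inner a c + inner b c.
Proof. unfold inner, vadd, sum3, Re, Im; simpl. ring. Qed.

Lemma inner_vscal_l (x : R) (a c : C3) : inner (vscal x a) c = x * inner a c.
Proof. unfold inner, vscal, sum3, Re, Im; simpl. ring. Qed.

Lemma omega_lin_r (v a b : C3) (x y : R) :
  omega v (vadd (vscal x a) (vscal y b)) = x * omega v a + y * omega v b.
Proof. unfold omega, vadd, vscal, sum3, Re, Im; simpl. ring. Qed.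

Lemma inner_comm (a b : C3) : inner a b = inner b a.
Proof. unfold inner, sum3; ring. Qed.

Lemma inner_vzero_l (a : C3) : inner vzero a = 0.
Proof. unfold inner, vzero, sum3, Re, Im; simpl. ring. Qed.

Lemma laplacian_special (alpha : R) (w : C) (f : R -> R -> C3)
  (Hf : special_surface alpha w f) (s t : R) :
  vadd (d_s (d_s f) s t) (d_t (d_t f) s t) =
  vscal (- 2 * energy alpha (f s t)) (f s t).
Proof.
  rewrite (special_d_ss alpha w f Hf), (special_d_tt alpha w f Hf).
  destruct Hf as [_ [_ Hadm]]. destruct (Hadm s t) as [H1 [H2 _]].
  set (v := f s t) in *.
  assert (H : forall j, - eig alpha j ^ 2 + mu alpha j *
      (mu alpha (next j) * sqmod v (next (next j)) +
       mu alpha (next (next j)) * sqmod v (next j)) = - 2 * energy alpha v).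
  { intros j.
    (* The two constraints homogenise the claim: multiplying by the sum 1 and subtracting a multiple
       of the sum 0 leaves an identity linear in the squared moduli. *)
    transitivity (- eig alpha j ^ 2 * sum3 (sqmod v) + mu alpha j *
      (mu alpha (next j) * sqmod v (next (next j)) +
       mu alpha (next (next j)) * sqmod v (next j))
      - eig alpha j * sum3 (fun j => eig alpha j * sqmod v j)).
    - rewrite H1, H2; ring.
    - unfold energy, sum3. destruct j; simpl; ring. }
  apply functional_extensionality; intros j.
  unfold vadd, vscal. rewrite <- (H j). rewrite RtoC_plus.
  ring.
Qed.

Lemma normal_part_lin (f : R -> R -> C3) (s t x y : R) (a b : C3) :
  detg f s t <> 0 ->
  vadd (vscal x (normal_part f s t a)) (vscal y (normal_part f s t b)) =
  normal_part f s t (vadd (vscal x a) (vscal y b)).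
Proof.
  intros Hd. unfold normal_part, tangent_part, vsub.
  rewrite !inner_vadd_l, !inner_vscal_l.
  apply C3_ext; intros j; unfold vadd, vscal, Re, Im; simpl; field; exact Hd.
Qed.

Lemma normal_part_radial (f : R -> R -> C3) (s t x : R) :
  in_S5 (f s t) -> inner (f s t) (d_s f s t) = 0 -> inner (f s t) (d_t f s t) = 0 ->
  normal_part f s t (vscal x (f s t)) = vzero.
Proof.
  unfold in_S5. intros H1 Hs Ht. unfold normal_part, tangent_part, vsub.
  rewrite !inner_vscal_l, H1, Hs, Ht.
  apply C3_ext; intros j; unfold vadd, vscal, vzero, Re, Im, Rdiv; simpl; ring.
Qed.

Lemma special_minimal_legendrian (alpha : R) (w : C) (f : R -> R -> C3) :
  special_surface alpha w f -> minimal_legendrian_immersion f.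
Proof.
  intros Hf. generalize Hf; intros [Hw [_ Hadm]].
  assert (Hds := special_d_s alpha w f Hf).
  assert (Hdt := special_d_t alpha w f Hf).
  assert (HS : forall s t, in_S5 (f s t)).
  { intros s t. destruct (Hadm s t) as [H1 _]. etransitivity; [| exact H1].
    unfold inner, sqmod, sum3. ring. }
  assert (E1 : forall s t, g11 f s t = energy alpha (f s t)).
  { intros. unfold g11. rewrite Hds. apply inner_ds_ds. }
  assert (E2 : forall s t, g12 f s t = 0).
  { intros. unfold g12. rewrite Hds, Hdt. apply inner_ds_dt. }
  assert (E3 : forall s t, g22 f s t = energy alpha (f s t)).
  { intros. unfold g22. rewrite Hdt. apply inner_dt_dt; auto. }
  assert (EP : forall s t, 0 < energy alpha (f s t)) by (intros; apply Hadm).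
  split; [split; [| split] | split].
  - intros j n s t.
    split; apply (poly_smooth alpha w f Hf); constructor.
  - exact HS.
  - intros s t a b H.
    assert (Ha : inner (Defs.differential f s t a b) (d_s f s t) = 0).
    { rewrite H. apply inner_vzero_l. }
    assert (Hb : inner (Defs.differential f s t a b) (d_t f s t) = 0).
    { rewrite H. apply inner_vzero_l. }
    unfold Defs.differential in Ha, Hb.
    rewrite inner_vadd_l, !inner_vscal_l in Ha, Hb.
    rewrite (inner_comm (d_t f s t) (d_s f s t)) in Ha.
    change (a * g11 f s t + b * g12 f s t = 0) in Ha.
    change (a * g12 f s t + b * g22 f s t = 0) in Hb.
    rewrite E1, E2 in Ha. rewrite E2, E3 in Hb. generalize (EP s t). intros.
    split; nra.
  - intros s t a b. unfold Defs.differential. rewrite omega_lin_r, Hds, Hdt.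
    rewrite omega_self_ds, omega_self_dt.
    destruct (Hadm s t) as [_ [H _]]. rewrite H. ring.
  - intros s t. unfold mean_curvature, II11, II22.
    assert (Hd : detg f s t <> 0).
    { unfold detg. rewrite E1, E2, E3. generalize (EP s t). intros. nra. }
    rewrite E2, E1, E3.
    set (e := energy alpha (f s t)).
    (* In a conformal parametrisation the trace of the second fundamental form involves only the
       normal part of [f_ss + f_tt], which is radial and hence projects to zero. *)
    transitivity (vscal (/ (2 * detg f s t))
      (vadd (vscal e (normal_part f s t (d_s (d_s f) s t)))
            (vscal e (normal_part f s t (d_t (d_t f) s t))))).
    { apply C3_ext; intros j; unfold vsub, vadd, vscal, Re, Im; simpl; ring. }
    rewrite normal_part_lin by exact Hd.
    replace (vadd (vscal e (d_s (d_s f) s t)) (vscal e (d_t (d_t f) s t)))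
      with (vscal (e * (- 2 * e)) (f s t)).
    2:{ transitivity (vscal e (vscal (- 2 * e) (f s t))).
        - apply C3_ext; intros j; unfold vscal, Re, Im; simpl; ring.
        - unfold e at 2. rewrite <- (laplacian_special alpha w f Hf).
          apply C3_ext; intros j; unfold vadd, vscal, Re, Im; simpl; ring. }
    rewrite normal_part_radial.
    + apply C3_ext; intros j; unfold vscal, vzero, Re, Im; simpl; ring.
    + apply HS.
    + rewrite Hds. apply inner_self_ds.
    + rewrite Hdt. apply inner_self_dt.
Qed.

(** * Surfaces swept out by a curve under [e^{As}] *)

Definition special_curve (alpha : R) (w : C) (z : R -> C3) : Prop :=
  Re w ^ 2 + Im w ^ 2 = 1 /\
  (forall j t,
     is_derive (fun y => Re (z y j)) t (Re (dt_field alpha w (z t) j)) /\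
     is_derive (fun y => Im (z y j)) t (Im (dt_field alpha w (z t) j))) /\
  forall t, admissible alpha (z t).

Lemma sqmod_exp_A (alpha s : R) (v : C3) (j : idx) :
  sqmod (exp_A alpha s v) j = sqmod v j.
Proof.
  unfold sqmod, exp_A, cis. destruct (v j) as [a b]. unfold Re, Im; simpl.
  generalize (sin2_cos2 (eig alpha j * s)). unfold Rsqr.
  set (c := cos _). set (d := sin _). intros H.
  transitivity ((d * d + c * c) * (a * a + b * b)); [ring | rewrite H; ring].
Qed.

(* [e^{As}] lies in SU(3) because the eigenvalues add up to 0. *)
Lemma dt_field_exp_A (alpha s : R) (w : C) (v : C3) (j : idx) :
  dt_field alpha w (exp_A alpha s v) j =
  Cmult (cis (eig alpha j * s)) (dt_field alpha w v j).
Proof.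
  set (k := next j). set (l := next k).
  assert (Hj : eig alpha j * s = - (eig alpha k * s + eig alpha l * s)).
  { unfold l, k. destruct j; simpl; ring. }
  unfold dt_field, exp_A, cis. fold k. fold l.
  rewrite Hj, cos_neg, sin_neg, cos_plus, sin_plus.
  destruct (v k) as [a b], (v l) as [c d]. unfold Re, Im, Cmult; simpl.
  f_equal; ring.
Qed.

(** The matrices [e^{As}] preserve all moduli and intertwine [dt_field], so the [t]-equation and
    admissibility need checking only on the curve; the [s]-equation holds by construction. *)
Lemma special_curve_surface (alpha : R) (w : C) (z : R -> C3) :
  special_curve alpha w z -> special_surface alpha w (fun s t => exp_A alpha s (z t)).
Proof.
  intros [Hw [Hz Hadm]]. split; [exact Hw | split].
  - intros j s t.
    destruct (Hz j t) as [HR HI].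
    set (e := eig alpha j).
    assert (HcR : continuity_2d_pt (fun _ y => Re (z y j)) s t).
    { apply (continuity_1d_2d_pt_comp (fun y => Re (z y j)) (fun _ y => y)).
      - apply derivable_continuous_pt. eexists. apply is_derive_Reals, HR.
      - apply continuity_2d_pt_id2. }
    assert (HcI : continuity_2d_pt (fun _ y => Im (z y j)) s t).
    { apply (continuity_1d_2d_pt_comp (fun y => Im (z y j)) (fun _ y => y)).
      - apply derivable_continuous_pt. eexists. apply is_derive_Reals, HI.
      - apply continuity_2d_pt_id2. }
    assert (Hcos : continuity_2d_pt (fun x _ => cos (e * x)) s t).
    { apply (continuity_1d_2d_pt_comp cos (fun x _ => e * x)).
      - apply continuity_cos.
      - apply continuity_2d_pt_mult;
          [apply continuity_2d_pt_const | apply continuity_2d_pt_id1]. }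
    assert (Hsin : continuity_2d_pt (fun x _ => sin (e * x)) s t).
    { apply (continuity_1d_2d_pt_comp sin (fun x _ => e * x)).
      - apply continuity_sin.
      - apply continuity_2d_pt_mult;
          [apply continuity_2d_pt_const | apply continuity_2d_pt_id1]. }
    split; [| split; [| split; [| split; [| split]]]].
    + apply (continuity_2d_pt_minus (fun x y => cos (e * x) * Re (z y j))
        (fun x y => sin (e * x) * Im (z y j)));
        apply continuity_2d_pt_mult; assumption.
    + apply (continuity_2d_pt_plus (fun x y => cos (e * x) * Im (z y j))
        (fun x y => sin (e * x) * Re (z y j)));
        apply continuity_2d_pt_mult; assumption.
    + unfold ds_field, exp_A, cis, Cmult, Re, Im; simpl. fold e.
      auto_derive; [trivial | ring].
    + unfold ds_field, exp_A, cis, Cmult, Re, Im; simpl. fold e.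
      auto_derive; [trivial | ring].
    + rewrite dt_field_exp_A. fold e.
      unfold exp_A, cis, Cmult. fold e. simpl.
      apply (is_derive_minus (V := R_NormedModule) (fun y => cos (e * s) * Re (z y j))
        (fun y => sin (e * s) * Im (z y j)));
        apply is_derive_scal; assumption.
    + rewrite dt_field_exp_A. fold e.
      unfold exp_A, cis, Cmult. fold e. simpl.
      apply (is_derive_plus (V := R_NormedModule) (fun y => cos (e * s) * Im (z y j))
        (fun y => sin (e * s) * Re (z y j)));
        apply is_derive_scal; assumption.
  - intros s t. destruct (Hadm t) as [H1 [H2 H3]].
    unfold admissible, sum3 in *. rewrite !sqmod_exp_A. auto.
Qed.

(** * Periods and quotient tori *)

Lemma periodic_nat {A : Type} (f : R -> A) (p : R) (n : nat) :
  (forall x, f (x + p) = f x) -> forall x, f (x + INR n * p) = f x.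
Proof.
  intros Hf. induction n as [| n IH]; intros x.
  - f_equal. simpl; ring.
  - rewrite S_INR. replace (x + (INR n + 1) * p) with (x + INR n * p + p) by ring.
    rewrite Hf; apply IH.
Qed.

Lemma periodic_Z {A : Type} (f : R -> A) (p : R) (n : Z) :
  (forall x, f (x + p) = f x) -> forall x, f (x + IZR n * p) = f x.
Proof.
  intros Hf x. destruct (Z.le_gt_cases 0 n) as [Hn | Hn].
  - rewrite <- (Z2Nat.id n Hn), <- INR_IZR_INZ. apply periodic_nat, Hf.
  - rewrite <- (periodic_nat f p (Z.to_nat (- n)) Hf).
    rewrite INR_IZR_INZ, Z2Nat.id by lia. rewrite opp_IZR. f_equal. ring.
Qed.

(** The lattice is rectangular, generated by [(S, 0)] and [(0, T)]. The induced map evaluates [f] at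
    a chosen representative of each coset, and periodicity makes the choice immaterial. *)
Lemma torus_of_periods (f : R -> R -> C3) (S T : R) :
  S <> 0 -> T <> 0 ->
  (forall s t, f (s + S) t = f s t) -> (forall s t, f s (t + T) = f s t) ->
  minimal_legendrian_immersion f ->
  exists L : R -> R -> Prop,
    doubly_periodic L f /\
    exists F : torus L -> C3,
      (forall s t, F (proj L s t) = f s t) /\ minimal_legendrian_torus L F.
Proof.
  intros HS HT HfS HfT Hf.
  set (L := fun x y => exists m n : Z,
    x = IZR m * S + IZR n * 0 /\ y = IZR m * 0 + IZR n * T).
  assert (HL : is_lattice L).
  { exists S, 0, 0, T. split; [| intros; reflexivity].
    rewrite Rmult_0_l, Rminus_0_r. apply Rmult_integral_contrapositive_currified; assumption. }
  assert (Hper : forall x y, L x y -> forall s t, f (s + x) (t + y) = f s t).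
  { intros x y [m [n [-> ->]]] s t.
    replace (s + (IZR m * S + IZR n * 0)) with (s + IZR m * S) by ring.
    replace (t + (IZR m * 0 + IZR n * T)) with (t + IZR n * T) by ring.
    rewrite (periodic_Z (fun y => f (s + IZR m * S) y) T n) by (intros; apply HfT).
    apply (periodic_Z (fun x => f x t) S m). intros; apply HfS. }
  exists L. split; [split; assumption |].
  assert (Hrep : forall c : torus L, exists v, exists s t,
    proj1_sig c = coset L s t /\ v = f s t).
  { intros [c [s [t Hc]]]. exists (f s t), s, t. split; [exact Hc | reflexivity]. }
  set (F := fun c => proj1_sig (constructive_indefinite_description _ (Hrep c))).
  assert (HF : forall s t, F (proj L s t) = f s t).
  { intros s t. unfold F.
    destruct (constructive_indefinite_description _ (Hrep (proj L s t)))
      as [v [s' [t' [Hc Hv]]]]. simpl in *. subst v.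
    (* The chosen representative [(s', t')] may differ from [(s, t)]; since the cosets agree, the
       difference is a lattice vector. *)
    assert (Hin : coset L s t s t).
    { exists 0%Z, 0%Z. split; ring. }
    rewrite Hc in Hin.
    rewrite <- (Hper _ _ Hin s' t'). f_equal; ring. }
  exists F. split; [exact HF |]. split; [exact HL |].
  replace (fun s t => F (proj L s t)) with f; [exact Hf |].
  apply functional_extensionality; intros s.
  apply functional_extensionality; intros t. symmetry; apply HF.
Qed.

Lemma cis_shift (x : R) (n : Z) : cis (x + IZR n * (2 * PI)) = cis x.
Proof.
  apply (periodic_Z cis (2 * PI) n).
  intros y. unfold cis.
  f_equal.
  - rewrite cos_plus, cos_2PI, sin_2PI. ring.
  - rewrite sin_plus, cos_2PI, sin_2PI. ring.
Qed.

(* No condition on the third eigenvalue: the three add up to 0. *)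
Lemma exp_A_shift (alpha p s : R) (m n : Z) (v : C3) :
  p = IZR m * (2 * PI) -> alpha * p = IZR n * (2 * PI) ->
  exp_A alpha (s + p) v = exp_A alpha s v.
Proof.
  intros Hm Hn. apply functional_extensionality; intros j.
  unfold exp_A. f_equal. destruct j; simpl.
  - rewrite !Rmult_1_l, Hm. apply cis_shift.
  - rewrite Rmult_plus_distr_l, Hn. apply cis_shift.
  - rewrite <- (cis_shift ((-1 - alpha) * s) (- m - n)). f_equal.
    rewrite minus_IZR, opp_IZR.
    transitivity ((-1 - alpha) * s - p - alpha * p); [ring |].
    rewrite Hn, Hm. ring.
Qed.

(** * Jacobi elliptic functions and the case J = 0 *)

Definition am_density (k x : R) : R := / sqrt (1 - k ^ 2 * sin x ^ 2).

Lemma am_radicand_bounds (k x : R) : k ^ 2 < 1 -> 0 < 1 - k ^ 2 * sin x ^ 2 <= 1.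
Proof.
  intros Hk. generalize (sin2_cos2 x) (pow2_ge_0 (cos x)) (pow2_ge_0 (sin x)) (pow2_ge_0 k).
  unfold Rsqr. simpl. nra.
Qed.

Lemma am_density_ge_1 (k x : R) : k ^ 2 < 1 -> 1 <= am_density k x.
Proof.
  intros Hk. destruct (am_radicand_bounds k x Hk) as [H0 H1]. unfold am_density.
  assert (Hs := sqrt_lt_R0 _ H0).
  apply Rle_trans with (/ 1); [rewrite Rinv_1; lra |].
  apply Rinv_le_contravar; [exact Hs |].
  apply Rle_trans with (sqrt 1); [apply sqrt_le_1_alt, H1 | rewrite sqrt_1; lra].
Qed.

Lemma continuous_am_density (k y : R) : k ^ 2 < 1 -> continuous (am_density k) y.
Proof.
  intros Hk.
  apply (ex_derive_continuous (V := R_NormedModule)).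
  destruct (am_radicand_bounds k y Hk) as [H0 _].
  unfold am_density. auto_derive.
  split; [simpl in *; lra | split; [| trivial]].
  apply Rgt_not_eq, sqrt_lt_R0. simpl in *; lra.
Qed.

Lemma am_density_primitive (k x : R) : k ^ 2 < 1 ->
  is_derive (fun b => RInt (am_density k) 0 b) x (am_density k x).
Proof.
  intros Hk. apply continuous_is_derive_RInt. intros y.
  apply continuous_am_density, Hk.
Qed.

(** The choice made by [epsilon] meets its specification as soon as some amplitude exists; a density
    of at least 1 makes the primitive surjective and supplies one. *)
Lemma am_inverse (k x : R) : k ^ 2 < 1 -> RInt (am_density k) 0 (am x k) = x.
Proof.
  intros Hk.
  destruct (primitive_surjective _ (am_density k) 1 Rlt_0_1
    (fun y => am_density_primitive k y Hk) (fun y => am_density_ge_1 k y Hk) x)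
    as [phi Hphi].
  apply is_RInt_unique. unfold am. apply epsilon_spec.
  exists phi. rewrite <- Hphi.
  apply (RInt_correct (V := R_CompleteNormedModule)).
  apply (ex_RInt_continuous (V := R_CompleteNormedModule)). intros y _.
  apply continuous_am_density, Hk.
Qed.

Lemma is_derive_am (k x : R) : k ^ 2 < 1 ->
  is_derive (fun x => am x k) x (dn x k).
Proof.
  intros Hk. unfold dn, sn.
  rewrite <- (Rinv_inv (sqrt _)).
  exact (primitive_inverse_derive _ (am_density k) (fun x => am x k) 1 Rlt_0_1
    (fun y => am_density_primitive k y Hk) (fun y => am_density_ge_1 k y Hk)
    (fun y => am_inverse k y Hk) x).
Qed.

(** The shift [T] is four times the complete elliptic integral of the first kind, here the integral
    of the density over a full turn. *)
Lemma am_shift (k : R) : k ^ 2 < 1 ->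
  exists T, 0 < T /\ forall x, am (x + T) k = am x k + 2 * PI.
Proof.
  intros Hk. set (G := fun b => RInt (am_density k) 0 b).
  exists (G (0 + 2 * PI) - G 0). split.
  - generalize (primitive_growth G (am_density k) 1
      (fun y => am_density_primitive k y Hk) (fun y => am_density_ge_1 k y Hk)
      0 (0 + 2 * PI)) PI_RGT_0. intros H H0.
    generalize (H ltac:(lra)). lra.
  - intros x. apply (primitive_inverse_shift G (am_density k) (fun x => am x k) 1
      (2 * PI) _ Rlt_0_1 (fun y => am_density_primitive k y Hk)
      (fun y => am_density_ge_1 k y Hk) (fun y => am_inverse k y Hk)).
    apply primitive_shift with (am_density k).
    + intros y; apply am_density_primitive, Hk.
    + intros y. unfold am_density. rewrite sin_plus, sin_2PI, cos_2PI.
      do 5 f_equal. ring.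
Qed.

Lemma is_derive_sn (k x : R) : k ^ 2 < 1 ->
  is_derive (fun x => sn x k) x (cn x k * dn x k).
Proof.
  intros Hk. unfold sn, cn. rewrite Rmult_comm.
  apply (is_derive_comp sin (fun x => am x k)); [apply is_derive_sin |].
  apply is_derive_am, Hk.
Qed.

Lemma is_derive_cn (k x : R) : k ^ 2 < 1 ->
  is_derive (fun x => cn x k) x (- sn x k * dn x k).
Proof.
  intros Hk. unfold sn, cn. rewrite Rmult_comm.
  apply (is_derive_comp cos (fun x => am x k)); [apply is_derive_cos |].
  apply is_derive_am, Hk.
Qed.

Lemma dn_sqr (k x : R) : k ^ 2 < 1 -> dn x k ^ 2 = 1 - k ^ 2 * sn x k ^ 2.
Proof.
  intros Hk. unfold dn. apply pow2_sqrt. left. apply am_radicand_bounds, Hk.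
Qed.

Lemma dn_pos (k x : R) : k ^ 2 < 1 -> 0 < dn x k.
Proof. intros Hk. apply sqrt_lt_R0, am_radicand_bounds, Hk. Qed.

Lemma is_derive_one_minus_sqr (f : R -> R) (c x l : R) :
  is_derive f x l -> is_derive (fun x => 1 - c * f x ^ 2) x (- (c * (2 * f x * l))).
Proof.
  intros Hf. auto_derive; [exists l; exact Hf |].
  replace (Derive (fun x => f x) x) with l by (symmetry; apply is_derive_unique, Hf).
  ring.
Qed.

Lemma is_derive_dn (k x : R) : k ^ 2 < 1 ->
  is_derive (fun x => dn x k) x (- k ^ 2 * sn x k * cn x k).
Proof.
  intros Hk. generalize (dn_pos k x Hk). intros Hd.
  evar_last.
  - apply (is_derive_sqrt (fun x => 1 - k ^ 2 * sn x k ^ 2) x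
      (- (k ^ 2 * (2 * sn x k * (cn x k * dn x k))))).
    + apply (is_derive_one_minus_sqr (fun x => sn x k)), is_derive_sn, Hk.
    + apply am_radicand_bounds, Hk.
  - change (sqrt (1 - k ^ 2 * sn x k ^ 2)) with (dn x k). field. lra.
Qed.

Definition modulus (alpha : R) : R := sqrt ((1 - alpha ^ 2) / (1 + 2 * alpha)).

Lemma modulus_sqr (alpha : R) : 0 < alpha <= 1 ->
  modulus alpha ^ 2 = (1 - alpha) * (1 + alpha) / (1 + 2 * alpha).
Proof.
  intros Ha. unfold modulus. rewrite pow2_sqrt.
  - unfold Rdiv. f_equal. ring.
  - apply Rmult_le_pos; [nra | left; apply Rinv_0_lt_compat; lra].
Qed.

(** This is [1 - alpha^2 < 1 + 2 alpha], where [alpha > 0] enters: at [alpha = 0] the modulus is 1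
    and the elliptic functions degenerate to hyperbolic ones, which are not periodic. *)
Lemma modulus_lt_1 (alpha : R) : 0 < alpha <= 1 -> modulus alpha ^ 2 < 1.
Proof.
  intros Ha. rewrite modulus_sqr by exact Ha.
  apply Rmult_lt_reg_r with (1 + 2 * alpha); [lra |].
  unfold Rdiv. rewrite Rmult_assoc, Rinv_l by lra. nra.
Qed.

(** The derivatives of [sn], [cn], [dn] form an Euler top, each being a multiple of the product of
    the other two. The amplitudes and the frequency [sqrt (1 + 2 alpha)] rescale its coefficients to
    the [mu j]. *)
Lemma is_derive_Rad0 (alpha : R) (j : idx) (t : R) : 0 < alpha <= 1 ->
  is_derive (Rad0 alpha j) t
    (mu alpha j * (Rad0 alpha (next j) t * Rad0 alpha (next (next j)) t)).
Proof.
  intros Ha. assert (Hk := modulus_lt_1 alpha Ha). assert (Hk2 := modulus_sqr alpha Ha).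
  unfold Rad0. fold (modulus alpha). set (k := modulus alpha) in *. clearbody k.
  rewrite !sqrt_div by lra. rewrite sqrt_1.
  assert (HA := sqrt_lt_R0 (1 + alpha) ltac:(lra)).
  assert (HB := sqrt_lt_R0 (2 + alpha) ltac:(lra)).
  assert (HD := sqrt_lt_R0 (1 + 2 * alpha) ltac:(lra)).
  assert (HA2 := sqrt_sqrt (1 + alpha) ltac:(lra)).
  assert (HB2 := sqrt_sqrt (2 + alpha) ltac:(lra)).
  assert (HD2 := sqrt_sqrt (1 + 2 * alpha) ltac:(lra)).
  set (a := sqrt (1 + alpha)) in *. set (b := sqrt (2 + alpha)) in *.
  set (d := sqrt (1 + 2 * alpha)) in *.
  assert (Hlin : is_derive (fun t => d * t) t d) by (auto_derive; [trivial | ring]).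
  assert (Hcomp : forall (f : R -> R) (l c m : R), is_derive f (d * t) l ->
    c * (d * l) = m -> is_derive (fun t => c * f (d * t)) t m).
  { intros f l c m Hf <-. apply is_derive_scal.
    apply (is_derive_comp f (fun t => d * t)); assumption. }
  destruct j; simpl next.
  - apply (Hcomp (fun x => cn x k) _ _ _ (is_derive_cn k (d * t) Hk)).
    unfold mu. replace (-1 - 2 * alpha) with (- (d * d)) by lra. field. lra.
  - apply (Hcomp (fun x => sn x k) _ _ _ (is_derive_sn k (d * t) Hk)).
    unfold mu. rewrite <- HB2. field. lra.
  - apply (Hcomp (fun x => dn x k) _ _ _ (is_derive_dn k (d * t) Hk)).
    unfold mu. rewrite Hk2, <- HA2, <- HD2. field. lra.
Qed.

Lemma Rad0_sqr (alpha t : R) : 0 < alpha <= 1 ->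
  Rad0 alpha i1 t ^ 2 + Rad0 alpha i2 t ^ 2 + Rad0 alpha i3 t ^ 2 = 1 /\
  Rad0 alpha i1 t ^ 2 + alpha * Rad0 alpha i2 t ^ 2 +
    (- 1 - alpha) * Rad0 alpha i3 t ^ 2 = 0.
Proof.
  intros Ha. assert (Hk := modulus_lt_1 alpha Ha). assert (Hk2 := modulus_sqr alpha Ha).
  unfold Rad0. fold (modulus alpha). set (k := modulus alpha) in *. clearbody k.
  set (x := sqrt (1 + 2 * alpha) * t).
  assert (Hs := dn_sqr k x Hk).
  assert (Hc : cn x k ^ 2 = 1 - sn x k ^ 2).
  { unfold cn, sn. generalize (sin2_cos2 (am x k)). unfold Rsqr. simpl. lra. }
  rewrite !Rpow_mult_distr, !pow2_sqrt, Hs, Hc, Hk2;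
    try (apply Rmult_le_pos; [lra | left; apply Rinv_0_lt_compat; lra]).
  split; field; lra.
Qed.

(** With the phase [w] carried by the first coordinate alone, [w] factors out of the first equation
    and cancels against its conjugate in the other two, leaving the real system for the radii. *)
Lemma special_curve_z0 (theta alpha : R) : 0 < alpha <= 1 ->
  special_curve alpha (cis (- (theta + PI / 2))) (z0 theta alpha).
Proof.
  intros Ha. set (phi := - (theta + PI / 2)).
  assert (Hphi : cos phi * cos phi + sin phi * sin phi = 1).
  { generalize (sin2_cos2 phi). unfold Rsqr. lra. }
  split; [simpl; lra | split].
  - intros j t.
    assert (H1 := is_derive_Rad0 alpha i1 t Ha).
    assert (H2 := is_derive_Rad0 alpha i2 t Ha).
    assert (H3 := is_derive_Rad0 alpha i3 t Ha).
    set (r1 := Rad0 alpha i1) in *. set (r2 := Rad0 alpha i2) in *.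
    set (r3 := Rad0 alpha i3) in *. simpl next in *.
    fold r1 r2 r3 in H1, H2, H3.
    unfold dt_field, z0; fold phi; fold r1 r2 r3; clearbody r1 r2 r3;
      destruct j; split; simpl.
    + apply is_derive_ext with (fun t => cos phi * r1 t); [intros y; unfold Re, Im; simpl; ring |].
      evar_last; [apply is_derive_scal, H1 | simpl; ring].
    + apply is_derive_ext with (fun t => sin phi * r1 t); [intros y; unfold Re, Im; simpl; ring |].
      evar_last; [apply is_derive_scal, H1 | simpl; ring].
    + evar_last; [apply H2 | simpl].
      transitivity ((2 + alpha) * (r3 t * r1 t) *
        (cos phi * cos phi + sin phi * sin phi)); [rewrite Hphi |]; ring.
    + evar_last; [apply (is_derive_const (V := R_NormedModule)) | unfold zero; simpl; ring].
    + evar_last; [apply H3 | simpl].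
      transitivity ((alpha - 1) * (r1 t * r2 t) *
        (cos phi * cos phi + sin phi * sin phi)); [rewrite Hphi |]; ring.
    + evar_last; [apply (is_derive_const (V := R_NormedModule)) | unfold zero; simpl; ring].
  - intros t. destruct (Rad0_sqr alpha t Ha) as [H1 H2].
    assert (E1 : sqmod (z0 theta alpha t) i1 = Rad0 alpha i1 t ^ 2).
    { transitivity ((cos phi * cos phi + sin phi * sin phi) * Rad0 alpha i1 t ^ 2);
        [| rewrite Hphi; ring].
      unfold sqmod, z0; fold phi; unfold Re, Im, Cmult, cis, RtoC, fst, snd. ring. }
    assert (E2 : sqmod (z0 theta alpha t) i2 = Rad0 alpha i2 t ^ 2).
    { unfold sqmod, z0, Re, Im, RtoC, fst, snd. ring. }
    assert (E3 : sqmod (z0 theta alpha t) i3 = Rad0 alpha i3 t ^ 2).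
    { unfold sqmod, z0, Re, Im, RtoC, fst, snd. ring. }
    unfold admissible, sum3. rewrite E1, E2, E3. unfold eig.
    set (a := Rad0 alpha i1 t ^ 2) in *. set (b := Rad0 alpha i2 t ^ 2) in *.
    set (c := Rad0 alpha i3 t ^ 2) in *.
    assert (0 <= a) by apply pow2_ge_0. assert (0 <= b) by apply pow2_ge_0.
    assert (0 <= c) by apply pow2_ge_0.
    split; [lra | split; [lra |]].
    (* The squared eigenvalues are [1], [alpha^2] and [(1 + alpha)^2], the smallest being
       [alpha^2]. *)
    apply Rlt_le_trans with (alpha ^ 2 * (a + b + c)); [nra |].
    assert (0 <= (1 - alpha ^ 2) * a) by (apply Rmult_le_pos; nra).
    assert (0 <= (1 + 2 * alpha) * c) by (apply Rmult_le_pos; nra).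
    lra.
Qed.

Lemma u_J0 (theta alpha s t : R) :
  u theta alpha 0 s t = exp_A alpha s (z0 theta alpha t).
Proof.
  unfold u. destruct (Req_EM_T 0 0) as [_ | H]; [reflexivity | contradiction H; reflexivity].
Qed.

Lemma torus_J0 (theta alpha : R) :
  (exists q : Q, alpha = Q2R q) -> 0 < alpha <= 1 ->
  exists L : R -> R -> Prop,
    doubly_periodic L (u theta alpha 0) /\
    exists F : torus L -> C3,
      (forall s t, F (proj L s t) = u theta alpha 0 s t) /\
      minimal_legendrian_torus L F.
Proof.
  intros [[a b] Hq] Ha. unfold Q2R in Hq; simpl in Hq.
  assert (Hb : 0 < IZR (Zpos b)) by (apply IZR_lt; reflexivity).
  set (r := sqrt (1 + 2 * alpha)).
  assert (Hr : 0 < r) by (apply sqrt_lt_R0; lra).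
  destruct (am_shift (modulus alpha) (modulus_lt_1 alpha Ha)) as [T [HT HTs]].
  generalize PI_RGT_0; intros Hpi.
  (* The denominator [b] of [alpha] makes both [p] and [alpha * p] multiples of [2 PI]; [T] is
     divided by [r] because the elliptic functions are evaluated at [r * t]. *)
  apply (torus_of_periods _ (IZR (Zpos b) * (2 * PI)) (T / r)).
  - apply Rgt_not_eq. apply Rmult_lt_0_compat; lra.
  - apply Rgt_not_eq. apply Rmult_lt_0_compat; [lra | apply Rinv_0_lt_compat, Hr].
  - intros s t. rewrite !u_J0. apply exp_A_shift with (Zpos b) a; [reflexivity |].
    rewrite Hq. field. lra.
  - intros s t. rewrite !u_J0. f_equal.
    assert (Hs : forall j, Rad0 alpha j (t + T / r) = Rad0 alpha j t).
    { intros j. unfold Rad0. fold (modulus alpha). fold r.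
      replace (r * (t + T / r)) with (r * t + T) by (field; lra).
      assert (Hsn : sn (r * t + T) (modulus alpha) = sn (r * t) (modulus alpha)).
      { unfold sn. rewrite HTs, sin_plus, cos_2PI, sin_2PI. ring. }
      assert (Hcn : cn (r * t + T) (modulus alpha) = cn (r * t) (modulus alpha)).
      { unfold cn. rewrite HTs, cos_plus, cos_2PI, sin_2PI. ring. }
      unfold dn. rewrite Hsn, Hcn. reflexivity. }
    apply functional_extensionality; intros j.
    unfold z0. rewrite !Hs. reflexivity.
  - replace (u theta alpha 0) with (fun s t => exp_A alpha s (z0 theta alpha t)).
    + eapply special_minimal_legendrian, special_curve_surface, special_curve_z0, Ha.
    + apply functional_extensionality; intros s.
      apply functional_extensionality; intros t. symmetry. apply u_J0.
Qed.

(** * The profile curve for alpha = 0 and J > 0 *)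

(* The energy equation [gamma'^2 / 4 + J^2 = Q gamma] is solved in closed form by an
   angle [x]: with [y = 1/3 + 2 gamma] it reads [gamma'^2 = y (1 - y)^2 - 4 J^2], and
   [y = 4/3 sin^2 beta] turns [y (1 - y)^2] into [4/27 sin^2 (3 beta)].  Writing
   [3 beta = PI/2 + chi] and [tan chi = m sin x], where [27 J^2 (1 + m^2) = 1], makes
   the right-hand side a perfect square. *)
Definition chi (m x : R) : R := atan (m * sin x).
Definition beta (m x : R) : R := PI / 6 + chi m x / 3.
Definition profile (m x : R) : R := 4 / 3 * sin (beta m x) ^ 2.

(* [d theta_2 / d x] *)
Definition angle_density (m x : R) : R := cos (beta m x) * (1 - profile m x).

(* [d t / d x] *)
Definition time_density (J m x : R) : R := angle_density m x * profile m x / (2 * J).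

(** At the turning points [sin x] is 1 or -1, so [cos^2 chi = 1 / (1 + m^2)]; equating
    [4/27 cos^2 chi] with [4 J^2] there gives this relation. It makes [m] range over the positive
    reals as [J] ranges over the open interval. *)
Definition linked (J m : R) : Prop := 0 < J /\ 0 < m /\ 27 * J ^ 2 * (1 + m ^ 2) = 1.

Lemma cos_chi_pos (m x : R) : 0 < cos (chi m x).
Proof. generalize (atan_bound (m * sin x)). intros. apply cos_gt_0; unfold chi; lra. Qed.

Lemma sin_chi (m x : R) : sin (chi m x) = m * sin x * cos (chi m x).
Proof.
  generalize (cos_chi_pos m x). intros H.
  rewrite <- (tan_atan (m * sin x)) at 1. unfold tan. fold (chi m x). field. lra.
Qed.

Lemma cos_chi_sqr (m x : R) : cos (chi m x) ^ 2 * (1 + (m * sin x) ^ 2) = 1.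
Proof.
  generalize (sin2_cos2 (chi m x)). rewrite sin_chi. unfold Rsqr. intros H.
  etransitivity; [| exact H]. ring.
Qed.

Lemma beta_bounds (m x : R) : 0 < beta m x < PI / 3.
Proof. unfold beta, chi. generalize (atan_bound (m * sin x)). lra. Qed.

Lemma sin_beta_pos (m x : R) : 0 < sin (beta m x).
Proof. generalize (beta_bounds m x) PI_RGT_0. intros. apply sin_gt_0; lra. Qed.

Lemma cos_beta_gt_half (m x : R) : 1 / 2 < cos (beta m x).
Proof.
  rewrite <- cos_PI3. generalize (beta_bounds m x) PI_RGT_0. intros.
  apply cos_decreasing_1; lra.
Qed.

Lemma triple_beta (m x : R) : 2 * beta m x + beta m x = PI / 2 + chi m x.
Proof. unfold beta. field. Qed.

Lemma sin_cos_beta (m x : R) : cos (beta m x) ^ 2 = 1 - sin (beta m x) ^ 2.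
Proof. generalize (sin2_cos2 (beta m x)). unfold Rsqr. simpl. lra. Qed.

(** Triple angle formula: [sin (3 beta) = 3 sin beta (1 - 4/3 sin^2 beta)], while
    [3 beta = PI/2 + chi]. The cosine version gives [sin_chi_profile]. *)
Lemma cos_chi_profile (m x : R) :
  cos (chi m x) = 3 * sin (beta m x) * (1 - profile m x).
Proof.
  assert (H : sin (2 * beta m x + beta m x) = cos (chi m x)).
  { rewrite triple_beta, sin_plus, sin_PI2, cos_PI2. ring. }
  rewrite <- H, sin_plus, sin_2a, cos_2a. unfold profile.
  generalize (sin_cos_beta m x).
  set (s := sin _). set (c := cos _). intros E.
  transitivity (2 * s * c ^ 2 + c ^ 2 * s - s ^ 3); [ring | rewrite E; field].
Qed.

Lemma sin_chi_profile (m x : R) :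
  - sin (chi m x) = cos (beta m x) * (1 - 3 * profile m x).
Proof.
  assert (H : cos (2 * beta m x + beta m x) = - sin (chi m x)).
  { rewrite triple_beta, cos_plus, sin_PI2, cos_PI2. ring. }
  rewrite <- H, cos_plus, sin_2a, cos_2a. unfold profile.
  generalize (sin_cos_beta m x).
  set (s := sin _). set (c := cos _). intros E.
  transitivity (c * (c ^ 2 - 3 * s ^ 2)); [ring | rewrite E; field].
Qed.

Lemma profile_bounds (m x : R) : 0 < profile m x < 1.
Proof.
  generalize (sin_beta_pos m x) (cos_chi_pos m x). rewrite cos_chi_profile.
  intros H1 H2. split; [unfold profile; nra | nra].
Qed.

Lemma profile_cubic (m x : R) :
  profile m x * (1 - profile m x) ^ 2 = 4 / 27 * cos (chi m x) ^ 2.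
Proof.
  rewrite cos_chi_profile. unfold profile at 1. field.
Qed.

Lemma profile_cubic_linked (J m x : R) : linked J m ->
  profile m x * (1 - profile m x) ^ 2 =
  4 * J ^ 2 + (2 * J * m * cos x * cos (chi m x)) ^ 2.
Proof.
  intros [_ [_ H]]. rewrite profile_cubic.
  generalize (cos_chi_sqr m x) (sin2_cos2 x). unfold Rsqr.
  set (c := cos (chi m x)). intros Hc Hx.
  transitivity (4 * J ^ 2 * (1 + m ^ 2) * c ^ 2).
  - transitivity (4 / 27 * (27 * J ^ 2 * (1 + m ^ 2)) * c ^ 2); [rewrite H |]; field.
  - transitivity (4 * J ^ 2 * (c ^ 2 * (1 + (m * sin x) ^ 2) +
      c ^ 2 * m ^ 2 * (1 - sin x * sin x))); [ring |].
    rewrite Hc. replace (1 - sin x * sin x) with (cos x * cos x) by lra. ring.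
Qed.

(** Here [cos beta > 1/2] and [y (1 - y) >= y (1 - y)^2 >= 4 J^2]. The bound persists at the turning
    points, so time can be inverted globally. *)
Lemma time_density_ge (J m x : R) : linked J m -> J <= time_density J m x.
Proof.
  intros HL. generalize (profile_cubic_linked J m x HL). destruct HL as [HJ _].
  generalize (profile_bounds m x) (cos_beta_gt_half m x).
  unfold time_density, angle_density.
  set (y := profile m x). set (c := cos (beta m x)).
  generalize (pow2_ge_0 (2 * J * m * cos x * cos (chi m x))).
  intros H0 Hy Hc H.
  assert (H1 : 4 * J ^ 2 <= y * (1 - y)) by nra.
  apply Rmult_le_reg_r with (2 * J); [lra |].
  unfold Rdiv. rewrite (Rmult_assoc _ (/ (2 * J))), Rinv_l by lra. nra.
Qed.

Lemma is_derive_chi (m x : R) :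
  is_derive (chi m) x (m * cos x * cos (chi m x) ^ 2).
Proof.
  unfold chi at 1. auto_derive; [trivial |].
  generalize (cos_chi_sqr m x). intros H.
  assert (0 < 1 + (m * sin x) ^ 2) by (generalize (pow2_ge_0 (m * sin x)); lra).
  replace (cos (chi m x) ^ 2) with (/ (1 + (m * sin x) ^ 2)).
  - unfold Rsqr. field. lra.
  - apply Rmult_eq_reg_r with (1 + (m * sin x) ^ 2); [| lra].
    rewrite H. apply Rinv_l. lra.
Qed.

Lemma is_derive_beta (m x : R) :
  is_derive (beta m) x (m * cos x * cos (chi m x) ^ 2 / 3).
Proof.
  unfold beta. evar_last.
  - apply (is_derive_plus (V := R_NormedModule)).
    + apply (is_derive_const (V := R_NormedModule)).
    + apply is_derive_ext with (fun x => / 3 * chi m x).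
      { intros y. unfold Rdiv. apply Rmult_comm. }
      apply is_derive_scal, is_derive_chi.
  - unfold plus, zero; simpl. field.
Qed.

Lemma is_derive_profile (m x : R) :
  is_derive (profile m) x
    (8 / 9 * sin (beta m x) * cos (beta m x) * (m * cos x * cos (chi m x) ^ 2)).
Proof.
  unfold profile. evar_last.
  - apply is_derive_scal.
    apply (is_derive_comp (fun b => sin b ^ 2) (beta m)).
    + auto_derive; [trivial | reflexivity].
    + apply is_derive_beta.
  - unfold scal; simpl; unfold mult; simpl. field.
Qed.

Lemma continuous_angle_density (m x : R) : continuous (angle_density m) x.
Proof.
  unfold angle_density.
  apply (continuous_mult (K := R_AbsRing) (fun x => cos (beta m x))
    (fun x => 1 - profile m x)).
  - apply (continuous_comp (beta m) cos).
    + eapply is_derive_continuous, is_derive_beta.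
    + apply continuous_cos.
  - apply (continuous_minus (V := R_NormedModule) (fun _ => 1) (profile m)).
    + apply continuous_const.
    + eapply is_derive_continuous, is_derive_profile.
Qed.

Lemma continuous_time_density (J m x : R) : continuous (time_density J m) x.
Proof.
  unfold time_density, Rdiv.
  apply (continuous_mult (K := R_AbsRing)
    (fun x => angle_density m x * profile m x) (fun _ => / (2 * J))).
  - apply (continuous_mult (K := R_AbsRing) (angle_density m) (profile m)).
    + apply continuous_angle_density.
    + eapply is_derive_continuous, is_derive_profile.
  - apply continuous_const.
Qed.

Lemma chi_period (m x : R) : chi m (x + 2 * PI) = chi m x.
Proof.
  unfold chi. rewrite sin_plus, cos_2PI, sin_2PI. do 2 f_equal. ring.
Qed.

Lemma profile_period (m x : R) : profile m (x + 2 * PI) = profile m x.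
Proof. unfold profile, beta. rewrite chi_period. reflexivity. Qed.

Lemma angle_density_period (m x : R) :
  angle_density m (x + 2 * PI) = angle_density m x.
Proof.
  unfold angle_density, beta. rewrite profile_period, chi_period. reflexivity.
Qed.

(** Time is measured from [x = PI / 2], where [profile] is largest and [gamma] should start at
    [gamma_+]; [T] is the time of one full oscillation. *)
Lemma parameter_exists (J m : R) : linked J m ->
  exists (psi : R -> R) (T : R), 0 < T /\ psi 0 = PI / 2 /\
    (forall t, is_derive psi t (/ time_density J m (psi t))) /\
    forall t, psi (t + T) = psi t + 2 * PI.
Proof.
  intros HL. assert (HJ : 0 < J) by apply HL.
  set (G := fun b => RInt (time_density J m) (PI / 2) b).
  assert (HG : forall x, is_derive G x (time_density J m x)).
  { intros x. apply continuous_is_derive_RInt. apply continuous_time_density. }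
  assert (HP : forall x, J <= time_density J m x)
    by (intros; apply time_density_ge, HL).
  assert (Hinv : forall t, {x | G x = t}).
  { intros t. apply constructive_indefinite_description.
    apply (primitive_surjective G (time_density J m) J); assumption. }
  set (psi := fun t => proj1_sig (Hinv t)).
  assert (Hpsi : forall t, G (psi t) = t) by (intros t; apply (proj2_sig (Hinv t))).
  exists psi, (G (0 + 2 * PI) - G 0).
  split; [| split; [| split]].
  - generalize PI_RGT_0; intros Hpi.
    assert (H0 : 0 <= 0 + 2 * PI) by lra.
    generalize (primitive_growth G _ J HG HP _ _ H0). nra.
  - apply (primitive_injective G (time_density J m) J HJ HG HP).
    rewrite Hpsi. unfold G. symmetry. apply (RInt_point (V := R_CompleteNormedModule)).
  - apply (primitive_inverse_derive G (time_density J m) psi J HJ HG HP Hpsi).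
  - apply (primitive_inverse_shift G (time_density J m) psi J (2 * PI) _ HJ HG HP Hpsi).
    apply primitive_shift with (time_density J m); [exact HG |].
    intros x. unfold time_density. rewrite angle_density_period, profile_period.
    reflexivity.
Qed.

(** * The rotation angle of the profile curve *)

Definition rotation (m : R) : R :=
  RInt (fun x => 2 / 3 * sqrt 3 * cos (chi m x / 3)) 0 PI.

(* The contributions of [x] and [x + PI] have opposite [chi], so the [sin chi] terms
   of [3 angle_density = 2 cos beta - sin chi] cancel. *)
Lemma angle_density_pair (m x : R) :
  angle_density m x + angle_density m (x + PI) = 2 / 3 * sqrt 3 * cos (chi m x / 3).
Proof.
  assert (Hk : forall x, angle_density m x = (2 * cos (beta m x) - sin (chi m x)) / 3).
  { intros z. unfold angle_density. generalize (sin_chi_profile m z). intros H. lra. }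
  assert (Hneg : chi m (x + PI) = - chi m x).
  { unfold chi. rewrite neg_sin, <- atan_opp. f_equal. ring. }
  rewrite !Hk. unfold beta. rewrite Hneg, sin_neg.
  replace (- chi m x / 3) with (- (chi m x / 3)) by field.
  rewrite !cos_plus, cos_neg, sin_neg, cos_PI6. field.
Qed.

Lemma continuous_chi_third (m x : R) :
  continuous (fun x => 2 / 3 * sqrt 3 * cos (chi m x / 3)) x.
Proof.
  apply (ex_derive_continuous (V := R_NormedModule)).
  unfold chi. auto_derive. trivial.
Qed.

Lemma rotation_total (m : R) : RInt (angle_density m) 0 (0 + 2 * PI) = rotation m.
Proof.
  assert (Hex : forall a b, ex_RInt (angle_density m) a b).
  { intros a b. apply (ex_RInt_continuous (V := R_CompleteNormedModule)).
    intros; apply continuous_angle_density. }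
  rewrite <- (RInt_Chasles (V := R_CompleteNormedModule) _ 0 PI) by apply Hex.
  assert (Hshift : RInt (angle_density m) PI (0 + 2 * PI) =
    RInt (fun x => angle_density m (x + PI)) 0 PI).
  { replace PI with (1 * 0 + PI) at 1 by ring.
    replace (0 + 2 * PI) with (1 * PI + PI) by ring.
    rewrite <- (RInt_comp_lin (V := R_CompleteNormedModule)) by apply Hex.
    apply RInt_ext. intros x _. unfold scal; simpl; unfold mult; simpl.
    rewrite !Rmult_1_l. reflexivity. }
  rewrite Hshift. unfold rotation.
  rewrite <- (RInt_plus (V := R_CompleteNormedModule)).
  - apply RInt_ext. intros x _. apply angle_density_pair.
  - apply Hex.
  - apply (ex_RInt_continuous (V := R_CompleteNormedModule)). intros x _.
    apply (continuous_comp (fun x => x + PI) (angle_density m)).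
    + apply (ex_derive_continuous (V := R_NormedModule)). auto_derive. trivial.
    + apply continuous_angle_density.
Qed.

(** The original [angle_density] decreases in [m] for [x] in [(0, PI)] but increases on
    [(PI, 2 PI)]. After pairing [x] with [x + PI] the integrand decreases strictly at every interior
    point. *)
Lemma rotation_decreasing (m n : R) : 0 <= m -> m < n -> rotation n < rotation m.
Proof.
  intros Hm Hmn. unfold rotation.
  apply RInt_lt; [apply PI_RGT_0 | | |]; try (intros; apply continuous_chi_third).
  intros x Hx. apply Rmult_lt_compat_l.
  - generalize (sqrt_lt_R0 3). lra.
  - assert (Hs := sin_gt_0 x (proj1 Hx) (proj2 Hx)).
    assert (H1 : atan (m * sin x) < atan (n * sin x)).
    { apply atan_increasing, Rmult_lt_compat_r; assumption. }
    assert (H0 : 0 <= atan (m * sin x)).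
    { rewrite <- atan_0. destruct (Req_dec m 0) as [-> | Hm0].
      - rewrite Rmult_0_l. lra.
      - left. apply atan_increasing, Rmult_lt_0_compat; lra. }
    generalize (atan_bound (n * sin x)) PI_RGT_0. intros.
    unfold chi. apply cos_decreasing_1; lra.
Qed.

(** The constant is uniform in [x], so the bound passes to the integral and gives continuity of
    [rotation]. *)
Lemma chi_third_lipschitz (x m n : R) :
  Rabs (cos (chi n x / 3) - cos (chi m x / 3)) <= Rabs (n - m).
Proof.
  destruct (MVT_gen (fun m => cos (chi m x / 3)) m n
    (fun m => - (sin (atan (m * sin x) / 3) * (sin x / (1 + (m * sin x) ^ 2) / 3))))
    as [z [_ Hz]].
  - intros y _. unfold chi. auto_derive; [trivial |].
    unfold Rsqr, Rdiv. field. generalize (pow2_ge_0 (y * sin x)). simpl.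
    intros; repeat split; lra.
  - intros y _. apply derivable_continuous_pt.
    apply ex_derive_Reals_0. unfold chi. auto_derive. trivial.
  - rewrite Hz, Rabs_mult. rewrite <- (Rmult_1_l (Rabs (n - m))) at 2.
    apply Rmult_le_compat_r; [apply Rabs_pos |].
    assert (Hsin : forall a, Rabs (sin a) <= 1).
    { intros a. apply Rabs_le. generalize (SIN_bound a). lra. }
    rewrite Rabs_Ropp. unfold Rdiv. rewrite !Rabs_mult, Rabs_inv.
    rewrite (Rabs_right (/ 3)) by lra.
    assert (H : 1 <= 1 + (z * sin x) ^ 2) by (generalize (pow2_ge_0 (z * sin x)); lra).
    rewrite (Rabs_right (1 + _)) by lra.
    assert (H' : 0 <= / (1 + (z * sin x) ^ 2) <= 1).
    { split; [left; apply Rinv_0_lt_compat; lra |].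
      rewrite <- Rinv_1. apply Rinv_le_contravar; lra. }
    assert (H1 := Hsin x). assert (H2 := Hsin (atan (z * sin x) * / 3)).
    assert (H3 := Rabs_pos (sin x)). assert (H4 := Rabs_pos (sin (atan (z * sin x) * / 3))).
    set (a := Rabs (sin x)) in *. set (b := Rabs (sin (atan _ * _))) in *.
    set (c := / _) in *.
    assert (a * c <= 1) by nra. assert (0 <= a * c) by nra. nra.
Qed.

Lemma rotation_continuous : continuity rotation.
Proof.
  set (K := 2 / 3 * sqrt 3).
  assert (HK : 0 < K) by (unfold K; generalize (sqrt_lt_R0 3); lra).
  generalize PI_RGT_0; intros Hpi.
  assert (HKP : 0 < PI * K) by (apply Rmult_lt_0_compat; lra).
  intros m eps Heps.
  exists (eps / (PI * K)). split.
  { apply Rmult_lt_0_compat; [exact Heps | apply Rinv_0_lt_compat, HKP]. }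
  intros n [_ Hn]. simpl in *. unfold Rdist in *.
  assert (Hex : forall m, ex_RInt (fun x => K * cos (chi m x / 3)) 0 PI).
  { intros k. apply (ex_RInt_continuous (V := R_CompleteNormedModule)).
    intros; apply continuous_chi_third. }
  apply Rle_lt_trans with ((PI - 0) * (K * Rabs (n - m))).
  - apply (norm_RInt_le_const (V := R_NormedModule)
      (fun x => minus (K * cos (chi n x / 3)) (K * cos (chi m x / 3))) 0 PI
      (minus (rotation n) (rotation m)) (K * Rabs (n - m))).
    + lra.
    + intros x _. change (Rabs (K * cos (chi n x / 3) - K * cos (chi m x / 3))
        <= K * Rabs (n - m)).
      rewrite <- Rmult_minus_distr_l, Rabs_mult, (Rabs_right K) by lra.
      apply Rmult_le_compat_l; [lra | apply chi_third_lipschitz].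
    + apply (is_RInt_minus (V := R_NormedModule));
        apply (RInt_correct (V := R_CompleteNormedModule)), Hex.
  - apply Rmult_lt_reg_r with (/ (PI * K)); [apply Rinv_0_lt_compat, HKP |].
    replace ((PI - 0) * (K * Rabs (n - m)) * / (PI * K)) with (Rabs (n - m))
      by (field; lra).
    exact Hn.
Qed.

(** * Density of the parameters with rational rotation *)

Lemma rational_between (a b : R) : a < b ->
  exists (p : Z) (q : positive), a < IZR p / IZR (Zpos q) < b.
Proof.
  intros Hab. destruct (archimed (/ (b - a))) as [Hq _].
  assert (Hi : 0 < / (b - a)) by (apply Rinv_0_lt_compat; lra).
  assert (Hq0 : (0 < up (/ (b - a)))%Z) by (apply lt_IZR; lra).
  destruct (up (/ (b - a))) as [| q | q] eqn:E; try lia.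
  set (r := IZR (Zpos q)) in *.
  destruct (archimed (r * a)) as [H1 H2].
  (* The first integer beyond [r * a] is at distance at most 1, which is less than [r * (b - a)]. *)
  exists (up (r * a)), q. fold r. set (p := IZR (up (r * a))) in *.
  assert (H3 : 1 < r * (b - a)).
  { apply Rmult_lt_reg_r with (/ (b - a)); [exact Hi |].
    rewrite Rmult_assoc, Rinv_r by lra. lra. }
  assert (Hr : 0 < r) by lra.
  split; apply Rmult_lt_reg_r with r; try exact Hr;
    unfold Rdiv; rewrite Rmult_assoc, Rinv_l by lra; lra.
Qed.

Definition modulus_J (J : R) : R := sqrt (/ (27 * J ^ 2) - 1).

Lemma linked_modulus_J (J : R) : 0 < J < 1 / (3 * sqrt 3) -> linked J (modulus_J J).
Proof.
  intros [HJ0 HJ].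
  assert (H3 := sqrt_lt_R0 3 ltac:(lra)).
  assert (H33 := sqrt_sqrt 3 ltac:(lra)).
  assert (Hlt : J * (3 * sqrt 3) < 1).
  { apply Rmult_lt_reg_r with (/ (3 * sqrt 3)); [apply Rinv_0_lt_compat; lra |].
    rewrite Rmult_assoc, Rinv_r by lra. lra. }
  assert (HJ2 : 27 * J ^ 2 < 1).
  { replace (27 * J ^ 2) with ((J * (3 * sqrt 3)) ^ 2) by
      (transitivity (9 * (sqrt 3 * sqrt 3) * J ^ 2); [ring | rewrite H33; ring]).
    assert (H0 : 0 < J * (3 * sqrt 3)) by (apply Rmult_lt_0_compat; lra).
    set (a := J * (3 * sqrt 3)) in *. clearbody a. nra. }
  assert (HJ2' : 0 < 27 * J ^ 2) by nra.
  assert (Hinv : 1 < / (27 * J ^ 2)).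
  { rewrite <- Rinv_1. apply Rinv_lt_contravar; lra. }
  split; [exact HJ0 | split].
  - apply sqrt_lt_R0. lra.
  - unfold modulus_J. rewrite pow2_sqrt by lra. field. lra.
Qed.

Lemma linked_exists (m : R) : 0 < m -> exists J, linked J m.
Proof.
  intros Hm. exists (sqrt (/ (27 * (1 + m ^ 2)))).
  assert (H : 0 < 27 * (1 + m ^ 2)) by nra.
  assert (Hi := Rinv_0_lt_compat _ H).
  split; [apply sqrt_lt_R0, Hi | split; [exact Hm |]].
  rewrite pow2_sqrt by lra. field. nra.
Qed.

Lemma linked_le (J K m n : R) : linked J m -> linked K n -> m <= n -> K <= J.
Proof.
  intros [HJ [Hm E]] [HK [Hn F]] H.
  apply Rnot_lt_le. intros Hlt.
  assert (J ^ 2 < K ^ 2) by nra.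
  assert (m ^ 2 <= n ^ 2) by nra.
  assert (0 < 1 + m ^ 2) by nra. nra.
Qed.

Lemma linked_bound (J m : R) : linked J m -> 0 < J < 1 / (3 * sqrt 3).
Proof.
  intros [HJ [Hm E]]. split; [exact HJ |].
  assert (H3 := sqrt_lt_R0 3 ltac:(lra)).
  assert (H33 := sqrt_sqrt 3 ltac:(lra)).
  apply Rmult_lt_reg_r with (3 * sqrt 3); [lra |].
  unfold Rdiv. rewrite Rmult_assoc, Rinv_l by lra.
  apply Rnot_le_lt. intros Hle.
  assert (1 * 1 <= (J * (3 * sqrt 3)) * (J * (3 * sqrt 3))) by nra.
  assert (27 * J ^ 2 = (J * (3 * sqrt 3)) * (J * (3 * sqrt 3))).
  { transitivity (9 * (sqrt 3 * sqrt 3) * J ^ 2); [rewrite H33 |]; ring. }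
  assert (0 < 27 * J ^ 2 * m ^ 2) by (apply Rmult_lt_0_compat; nra).
  nra.
Qed.

Definition rational_rotation (J : R) : Prop :=
  exists m p q, linked J m /\ rotation m = 2 * PI * (IZR p / IZR (Zpos q)).

Lemma rational_rotation_dense : dense_in rational_rotation 0 (1 / (3 * sqrt 3)).
Proof.
  split.
  - intros J [m [p [q [HL _]]]]. exact (linked_bound J m HL).
  - intros J HJ eps Heps. set (top := 1 / (3 * sqrt 3)) in *.
    (* A second parameter to the right of [J], within [eps] and still below [top]; the parameter
       found will lie between [J] and [K]. *)
    set (K := J + Rmin (eps / 2) ((top - J) / 2)).
    assert (Hmin : 0 < Rmin (eps / 2) ((top - J) / 2)) by (apply Rmin_glb_lt; lra).
    assert (HK : 0 < K < top).
    { unfold K. generalize (Rmin_r (eps / 2) ((top - J) / 2)). lra. }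
    assert (HKe : K < J + eps).
    { unfold K. generalize (Rmin_l (eps / 2) ((top - J) / 2)). lra. }
    assert (HLJ := linked_modulus_J J HJ). assert (HLK := linked_modulus_J K HK).
    set (m := modulus_J J) in *. set (n := modulus_J K) in *.
    assert (Hnm : n < m).
    { apply Rnot_le_lt. intros Hle. generalize (linked_le J K m n HLJ HLK Hle).
      unfold K. lra. }
    assert (Hn : 0 < n) by apply HLK.
    assert (Hrot := rotation_decreasing n m (Rlt_le _ _ Hn) Hnm).
    generalize PI_RGT_0; intros Hpi.
    assert (Hi : 0 < / (2 * PI)) by (apply Rinv_0_lt_compat; lra).
    destruct (rational_between (rotation m * / (2 * PI)) (rotation n * / (2 * PI)))
      as [p [q [H1 H2]]]; [apply Rmult_lt_compat_r; assumption |].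
    set (r := IZR p / IZR (Zpos q)) in *.
    assert (H3 : rotation m < 2 * PI * r < rotation n).
    { split; apply Rmult_lt_reg_r with (/ (2 * PI)); try exact Hi;
        replace (2 * PI * r * / (2 * PI)) with r by (field; lra); assumption. }
    destruct (IVT_gen rotation n m (2 * PI * r)) as [k [Hk Hkr]].
    + apply rotation_continuous.
    + rewrite Rmin_right, Rmax_left; lra.
    + rewrite Rmin_left, Rmax_right in Hk by lra.
      destruct (linked_exists k ltac:(lra)) as [I HI].
      exists I. split; [exists k, p, q; split; assumption |].
      generalize (linked_le _ _ _ _ HI HLJ (proj2 Hk))
        (linked_le _ _ _ _ HLK HI (proj1 Hk)). intros.
      apply Rabs_def1; lra.
Qed.

(** * Identification of gamma and of the angles *)

(* Gronwall for [d^2 + d'^2]. *)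
Lemma linear_ode_zero_pos (d e c : R -> R) :
  (forall t, is_derive d t (e t)) -> (forall t, is_derive e t (c t * d t)) ->
  (forall t, continuous c t) -> d 0 = 0 -> e 0 = 0 ->
  forall t, 0 <= t -> d t = 0.
Proof.
  intros Hd He Hc Hd0 He0 t Ht.
  destruct (continuity_ab_maj (fun x => Rabs (1 + c x)) 0 t Ht) as [x0 [Hx0 _]].
  { intros x _. apply (continuity_pt_comp (fun x => 1 + c x) Rabs).
    - apply continuity_pt_plus; [apply continuity_pt_const; intros ? ?; reflexivity |].
      apply continuity_pt_filterlim, Hc.
    - apply Rcontinuity_abs. }
  set (M := Rabs (1 + c x0)) in *.
  (* The derivative of [d^2 + e^2] is [2 (1 + c) d e], at most [M (d^2 + e^2)] on [[0, t]], so the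
     exponential weight makes [f] nonincreasing there. *)
  set (f := fun x => (d x ^ 2 + e x ^ 2) * exp (- M * x)).
  set (df := fun x => (2 * (1 + c x) * (d x * e x) - M * (d x ^ 2 + e x ^ 2))
    * exp (- M * x)).
  assert (Hf : forall x, is_derive f x (df x)).
  { intros x. unfold f, df. auto_derive.
    - split; [eexists; apply Hd |]. split; [eexists; apply He | trivial].
    - replace (Derive (fun x => d x) x) with (e x) by
        (symmetry; apply is_derive_unique, Hd).
      replace (Derive (fun x => e x) x) with (c x * d x) by
        (symmetry; apply is_derive_unique, He).
      ring. }
  destruct (MVT_gen f 0 t df) as [x [Hx E]].
  - intros; apply Hf.
  - intros x _. apply derivable_continuous_pt.
    exists (df x). apply is_derive_Reals, Hf.
  - rewrite Rmin_left, Rmax_right in Hx by exact Ht.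
    assert (Hdf : df x <= 0).
    { unfold df. generalize (exp_pos (- M * x)). intros Hexp.
      assert (HM : Rabs (1 + c x) <= M) by (apply Hx0, Hx).
      generalize (Rle_abs (1 + c x)) (Rle_abs (- (1 + c x))).
      rewrite Rabs_Ropp. intros H1 H2.
      assert (H3 : 2 * (1 + c x) * (d x * e x) <= M * (d x ^ 2 + e x ^ 2)).
      { generalize (pow2_ge_0 (d x + e x)) (pow2_ge_0 (d x - e x)).
        set (k := 1 + c x) in *. intros H3 H4.
        assert (0 <= (M - k) * (d x + e x) ^ 2) by (apply Rmult_le_pos; lra).
        assert (0 <= (M + k) * (d x - e x) ^ 2) by (apply Rmult_le_pos; lra).
        nra. }
      nra. }
    assert (Hft : f t <= 0).
    { assert (f 0 = 0) by (unfold f; rewrite Hd0, He0; ring).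
      assert (0 <= - df x * (t - 0)) by (apply Rmult_le_pos; lra). lra. }
    unfold f in Hft. generalize (exp_pos (- M * t)). intros Hexp.
    generalize (pow2_ge_0 (d t)) (pow2_ge_0 (e t)). intros H1 H2.
    assert (H3 : d t ^ 2 + e t ^ 2 <= 0).
    { apply Rmult_le_reg_r with (exp (- M * t)); [exact Hexp | lra]. }
    assert (H4 : (d t) * (d t) = 0) by lra.
    destruct (Rmult_integral _ _ H4); assumption.
Qed.

Lemma is_derive_reverse (f : R -> R) (t l : R) :
  is_derive f (- t) l -> is_derive (fun t => f (- t)) t (- l).
Proof.
  intros H. evar_last.
  - apply (is_derive_comp f (fun t => - t)); [exact H |].
    auto_derive; [trivial | reflexivity].
  - unfold scal; simpl; unfold mult; simpl. ring.
Qed.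

Lemma linear_ode_zero (d e c : R -> R) :
  (forall t, is_derive d t (e t)) -> (forall t, is_derive e t (c t * d t)) ->
  (forall t, continuous c t) -> d 0 = 0 -> e 0 = 0 -> forall t, d t = 0.
Proof.
  intros Hd He Hc Hd0 He0 t. destruct (Rle_or_lt 0 t) as [Ht | Ht].
  - apply (linear_ode_zero_pos d e c); assumption.
  - rewrite <- (Ropp_involutive t).
    apply (linear_ode_zero_pos (fun t => d (- t)) (fun t => - e (- t)) (fun t => c (- t))).
    + intros x. apply is_derive_reverse, Hd.
    + intros x. replace (c (- x) * d (- x)) with (- (- (c (- x) * d (- x)))) by ring.
      apply (is_derive_opp (V := R_NormedModule)), is_derive_reverse, He.
    + intros x. apply (continuous_comp (fun x => - x) c); [| apply Hc].
      apply (ex_derive_continuous (V := R_NormedModule)). auto_derive. trivial.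
    + rewrite Ropp_0; exact Hd0.
    + rewrite Ropp_0, He0. ring.
    + lra.
Qed.

Lemma Qcubic_0 (x : R) : Qcubic 0 x = (1 / 3 - x) ^ 2 * (1 / 3 + 2 * x).
Proof. unfold Qcubic, mu. ring. Qed.

Lemma Derive_Qcubic_0 (x : R) : Derive (Qcubic 0) x = 6 * x ^ 2 - 2 * x.
Proof.
  apply is_derive_unique. unfold Qcubic, mu. auto_derive; [trivial |]. field.
Qed.

(** The force [2 Q'] is quadratic, so its difference at [g] and [h] factors as
    [(12 (g + h) - 4) (g - h)] and the difference of two solutions obeys a linear equation. The
    initial values agree because a least root is unique. *)
Lemma is_gamma_unique (J : R) (g h : R -> R) :
  is_gamma 0 J g -> is_gamma 0 J h -> forall t, g t = h t.
Proof.
  intros [Hg0 [Hg1 Hg]] [Hh0 [Hh1 Hh]] t.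
  enough (g t - h t = 0) by lra.
  apply (linear_ode_zero (fun t => g t - h t) (fun t => Derive g t - Derive h t)
    (fun t => 12 * (g t + h t) - 4)).
  - intros x. apply (is_derive_minus (V := R_NormedModule));
      apply Derive_correct; [apply Hg | apply Hh].
  - intros x. evar_last.
    + apply (is_derive_minus (V := R_NormedModule)); [apply Hg | apply Hh].
    + rewrite !Derive_Qcubic_0. unfold minus, plus, opp; simpl. ring.
  - intros x. apply (ex_derive_continuous (V := R_NormedModule)).
    auto_derive. split; [apply Hg | split; [apply Hh | trivial]].
  - destruct Hg0 as [A1 [A2 A3]], Hh0 as [B1 [B2 B3]].
    generalize (A3 _ B1 B2) (B3 _ A1 A2). lra.
  - rewrite (is_derive_unique _ _ _ Hg1), (is_derive_unique _ _ _ Hh1). ring.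
Qed.

Definition gamma_sol (m : R) (psi : R -> R) (t : R) : R := (profile m (psi t) - 1 / 3) / 2.

(** A square root of [profile * (1 - profile)^2 - 4 J^2] whose sign, carried by [cos (psi t)],
    changes at the turning points. *)
Definition gamma_speed (J m : R) (psi : R -> R) (t : R) : R :=
  2 * J * m * (cos (psi t) * cos (chi m (psi t))).

Lemma is_derive_gamma_sol (J m : R) (psi : R -> R) (t : R) : linked J m ->
  is_derive psi t (/ time_density J m (psi t)) ->
  is_derive (gamma_sol m psi) t (gamma_speed J m psi t).
Proof.
  intros [HJ [Hm _]] Hpsi. unfold gamma_sol, gamma_speed. evar_last.
  - apply is_derive_ext with (fun t => / 2 * (profile m (psi t) - 1 / 3)).
    { intros x. unfold Rdiv. apply Rmult_comm. }
    apply is_derive_scal. apply (is_derive_minus (V := R_NormedModule)).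
    + apply (is_derive_comp (profile m) psi); [apply is_derive_profile | exact Hpsi].
    + apply (is_derive_const (V := R_NormedModule)).
  - unfold minus, plus, opp, scal, zero; simpl; unfold mult; simpl.
    unfold time_density, angle_density.
    assert (Hs := sin_beta_pos m (psi t)). assert (Hy := profile_bounds m (psi t)).
    assert (Hb := cos_beta_gt_half m (psi t)).
    rewrite (cos_chi_profile m (psi t)).
    assert (E : profile m (psi t) = 4 / 3 * sin (beta m (psi t)) ^ 2) by reflexivity.
    set (y := profile m (psi t)) in *. set (s := sin (beta m (psi t))) in *.
    set (c := cos (beta m (psi t))) in *.
    transitivity (4 / 3 * s ^ 2 * (6 * J * m * cos (psi t) * s * (1 - y) / y)).
    + field. repeat split; lra.
    + rewrite <- E. field. lra.
Qed.

(** Differentiating the energy equation would give this only where [gamma' <> 0]; the closed form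
    for the speed is differentiated directly instead, turning points included. *)
Lemma is_derive_gamma_speed (J m : R) (psi : R -> R) (t : R) : linked J m ->
  is_derive psi t (/ time_density J m (psi t)) ->
  is_derive (gamma_speed J m psi) t (2 * Derive (Qcubic 0) (gamma_sol m psi t)).
Proof.
  intros HL Hpsi. rewrite Derive_Qcubic_0.
  set (x := psi t). unfold gamma_speed. evar_last.
  - apply is_derive_scal.
    apply (is_derive_comp (fun x => cos x * cos (chi m x)) psi); [| exact Hpsi].
    apply (is_derive_mult cos (fun x => cos (chi m x))).
    + apply is_derive_cos.
    + apply (is_derive_comp cos (chi m)); [apply is_derive_cos | apply is_derive_chi].
    + intros; apply Rmult_comm.
  - fold x. unfold plus, scal; simpl; unfold mult; simpl.
    unfold gamma_sol. fold x. unfold time_density, angle_density.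
    assert (Hs := sin_beta_pos m x). assert (Hy := profile_bounds m x).
    assert (Hb := cos_beta_gt_half m x).
    assert (Hcub := profile_cubic m x). assert (Hsin := sin_chi m x).
    assert (Hbeta := sin_chi_profile m x).
    assert (Hlk := profile_cubic_linked J m x HL).
    destruct HL as [HJ [Hm HE]].
    set (y := profile m x) in *. set (b := cos (beta m x)) in *.
    set (c := cos (chi m x)) in *. set (s := sin (chi m x)) in *.
    apply Rmult_eq_reg_r with (b * (1 - y) * y);
      [| apply Rgt_not_eq; repeat apply Rmult_lt_0_compat; lra].
    transitivity (- (4 * J ^ 2 * (m * sin x * c + s * (m * cos x * c) ^ 2))).
    { field. repeat split; lra. }
    (* With [s = m sin x cos chi] the bracket becomes [s] times the perfect-square expression for
       [y (1 - y)^2]. *)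
    rewrite <- Hsin.
    transitivity (- s * (y * (1 - y) ^ 2)); [rewrite Hlk; ring |].
    rewrite Hbeta. field.
Qed.

Lemma gamma_energy (J m : R) (psi : R -> R) (t : R) : linked J m ->
  gamma_speed J m psi t ^ 2 / 4 + J ^ 2 = Qcubic 0 (gamma_sol m psi t).
Proof.
  intros HL. generalize (profile_cubic_linked J m (psi t) HL).
  rewrite Qcubic_0. unfold gamma_sol, gamma_speed. intros H.
  transitivity ((4 * J ^ 2 + (2 * J * m * cos (psi t) * cos (chi m (psi t))) ^ 2) / 4);
    [field | rewrite <- H; field].
Qed.

Lemma gamma_sol_bounds (m : R) (psi : R -> R) (t : R) :
  0 < 1 / 3 + 2 * gamma_sol m psi t /\ 0 < 1 / 3 - gamma_sol m psi t.
Proof. unfold gamma_sol. generalize (profile_bounds m (psi t)). lra. Qed.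

Lemma is_gamma_sol (J m : R) (psi : R -> R) : linked J m -> psi 0 = PI / 2 ->
  (forall t, is_derive psi t (/ time_density J m (psi t))) ->
  is_gamma 0 J (gamma_sol m psi).
Proof.
  intros HL H0 Hpsi.
  assert (Hd := fun t => is_derive_gamma_sol J m psi t HL (Hpsi t)).
  assert (Hspeed : gamma_speed J m psi 0 = 0).
  { unfold gamma_speed. rewrite H0, cos_PI2. ring. }
  split; [| split].
  - assert (Hq := gamma_energy J m psi 0 HL).
    rewrite Hspeed in Hq.
    assert (HG : 0 <= gamma_sol m psi 0).
    { generalize (sin_chi_profile m (psi 0)) (sin_chi m (psi 0)) (cos_chi_pos m (psi 0))
        (cos_beta_gt_half m (psi 0)).
      unfold gamma_sol. rewrite H0, sin_PI2. intros E F Hc Hb.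
      assert (0 < m * 1 * cos (chi m (PI / 2))).
      { apply Rmult_lt_0_compat; [| exact Hc]. rewrite Rmult_1_r. apply HL. }
      nra. }
    destruct (gamma_sol_bounds m psi 0) as [_ Hlt].
    split; [exact HG | split].
    + rewrite <- Hq. field.
    + intros y Hy Ey. apply Rnot_lt_le. intros Hyx.
      rewrite <- Ey in Hq. rewrite !Qcubic_0 in Hq.
      set (x := gamma_sol m psi 0) in *.
      (* [Q] is strictly decreasing on [[0, 1/3]]: the divided difference cannot vanish for
         [0 <= y < x < 1/3], so no smaller nonnegative root exists. *)
      assert (E : (x - y) * ((x + y) - 2 * (x ^ 2 + x * y + y ^ 2)) = 0).
      { rewrite Qcubic_0 in Ey. lra. }
      assert (Hz : (x + y) - 2 * (x ^ 2 + x * y + y ^ 2) = 0).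
      { apply Rmult_eq_reg_l with (x - y); [rewrite E; ring | lra]. }
      nra.
  - rewrite <- Hspeed at 2. apply Hd.
  - intros t. split; [eexists; apply Hd |].
    apply is_derive_ext with (gamma_speed J m psi).
    + intros x. symmetry. apply is_derive_unique, Hd.
    + apply is_derive_gamma_speed; auto.
Qed.

(** Existence of one solution makes the choice by [epsilon] a solution; uniqueness then identifies
    the two. *)
Lemma gamma_eq_sol (J m : R) (psi : R -> R) : linked J m -> psi 0 = PI / 2 ->
  (forall t, is_derive psi t (/ time_density J m (psi t))) ->
  forall t, gamma 0 J t = gamma_sol m psi t.
Proof.
  intros HL H0 Hpsi. assert (H := is_gamma_sol J m psi HL H0 Hpsi).
  apply (is_gamma_unique J); [| exact H].
  unfold gamma. apply epsilon_spec. exists (gamma_sol m psi). exact H.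
Qed.

(** * The curve in polar coordinates for [alpha = 0] *)

Definition parametrises (J m : R) (psi : R -> R) : Prop :=
  linked J m /\ psi 0 = PI / 2 /\
  forall t, is_derive psi t (/ time_density J m (psi t)).

Definition radicand (m : R) (psi : R -> R) (j : idx) (t : R) : R :=
  1 / 3 + mu 0 j * gamma_sol m psi t.

Lemma radicand_pos (m : R) (psi : R -> R) (j : idx) (t : R) : 0 < radicand m psi j t.
Proof.
  unfold radicand. destruct (gamma_sol_bounds m psi t).
  destruct j; simpl; lra.
Qed.

Lemma Rad_radicand (J m : R) (psi : R -> R) (j : idx) (t : R) : parametrises J m psi ->
  Rad 0 J j t = sqrt (radicand m psi j t).
Proof.
  intros [HL [H0 Hpsi]]. unfold Rad, radicand.
  rewrite (gamma_eq_sol J m psi HL H0 Hpsi). reflexivity.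
Qed.

Lemma is_derive_radicand (J m : R) (psi : R -> R) (j : idx) (t : R) :
  parametrises J m psi ->
  is_derive (radicand m psi j) t (mu 0 j * gamma_speed J m psi t).
Proof.
  intros [HL [_ Hpsi]]. unfold radicand. evar_last.
  - apply (is_derive_plus (V := R_NormedModule)).
    + apply (is_derive_const (V := R_NormedModule)).
    + apply is_derive_scal, is_derive_gamma_sol; [exact HL | apply Hpsi].
  - apply Rplus_0_l.
Qed.

Lemma is_derive_angle (theta J m : R) (psi : R -> R) (j : idx) (t : R) :
  parametrises J m psi ->
  is_derive (angle theta 0 J j) t (J * mu 0 j / radicand m psi j t).
Proof.
  intros HP. unfold angle. evar_last.
  - apply (is_derive_plus (V := R_NormedModule)).
    + apply (is_derive_const (V := R_NormedModule)).
    + apply is_derive_ext with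
        (fun t => RInt (fun x => J * mu 0 j / radicand m psi j x) 0 t).
      * intros y. apply RInt_ext. intros x _. rewrite (Rad_radicand J m psi) by exact HP.
        rewrite pow2_sqrt; [reflexivity | left; apply radicand_pos].
      * apply (continuous_is_derive_RInt (fun x => J * mu 0 j / radicand m psi j x)).
        intros x. apply (continuous_mult (K := R_AbsRing) (fun _ => J * mu 0 j)
          (fun x => / radicand m psi j x)).
        -- apply continuous_const.
        -- eapply is_derive_continuous, is_derive_inv;
             [apply (is_derive_radicand J), HP | apply Rgt_not_eq, radicand_pos].
  - apply Rplus_0_l.
Qed.

Lemma angle_0 (theta J : R) (j : idx) :
  angle theta 0 J j 0 = match j with i1 => - theta | _ => 0 end.
Proof.
  unfold angle. rewrite (RInt_point (V := R_CompleteNormedModule)).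
  destruct j; apply Rplus_0_r.
Qed.

(** The left side is an argument of [e^{i theta} z_1 z_2 z_3], which will turn out to be
    [J + i gamma' / 2]. The equality is exact, not merely modulo [2 PI]: both sides start at 0 and
    have equal derivatives by the energy equation. *)
Lemma angle_sum (theta J m : R) (psi : R -> R) (t : R) : parametrises J m psi ->
  sum3 (fun j => angle theta 0 J j t) + theta =
  atan (gamma_speed J m psi t / (2 * J)).
Proof.
  intros HP. generalize HP. intros [HL [H0 Hpsi]]. assert (HJ : 0 < J) by apply HL.
  apply (is_derive_eq_const (fun t => sum3 (fun j => angle theta 0 J j t) + theta)
    (fun t => atan (gamma_speed J m psi t / (2 * J)))
    (fun t => sum3 (fun j => J * mu 0 j / radicand m psi j t)) 0).
  - intros x. unfold sum3. evar_last.
    + apply (is_derive_plus (V := R_NormedModule));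
        [| apply (is_derive_const (V := R_NormedModule))].
      apply (is_derive_plus (V := R_NormedModule));
        [apply (is_derive_plus (V := R_NormedModule)) |]; apply is_derive_angle, HP.
    + apply Rplus_0_r.
  - intros x. evar_last.
    + apply (is_derive_comp atan (fun t => gamma_speed J m psi t / (2 * J)));
        [apply is_derive_atan |].
      apply is_derive_ext with (fun t => / (2 * J) * gamma_speed J m psi t).
      { intros y. unfold Rdiv. apply Rmult_comm. }
      apply is_derive_scal, is_derive_gamma_speed; [exact HL | apply Hpsi].
    + rewrite Derive_Qcubic_0. unfold scal; simpl; unfold mult; simpl.
      unfold sum3, Rsqr, radicand, mu.
      generalize (gamma_energy J m psi x HL). rewrite Qcubic_0.
      destruct (gamma_sol_bounds m psi x) as [B1 B2].
      set (v := gamma_speed J m psi x) in *. set (g := gamma_sol m psi x) in *.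
      intros E.
      assert (E' : 1 + v / (2 * J) * (v / (2 * J)) =
        (1 / 3 - g) ^ 2 * (1 / 3 + 2 * g) / J ^ 2) by (rewrite <- E; field; lra).
      rewrite E'. field. repeat split; lra.
  - unfold sum3. rewrite !angle_0. unfold gamma_speed. rewrite H0, cos_PI2.
    replace (2 * J * m * (0 * cos (chi m (PI / 2))) / (2 * J)) with 0 by (field; lra).
    rewrite atan_0. ring.
Qed.

(** In complex form [e^{i theta} z_1 z_2 z_3 = J + i gamma' / 2]: the energy equation supplies the
    modulus, [angle_sum] the argument. *)
Lemma radii_product (theta J m : R) (psi : R -> R) (t : R) : parametrises J m psi ->
  let sigma := sum3 (fun j => angle theta 0 J j t) + theta in
  let N := Rad 0 J i1 t * Rad 0 J i2 t * Rad 0 J i3 t in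
  N * cos sigma = J /\ N * sin sigma = gamma_speed J m psi t / 2.
Proof.
  intros HP sigma N. generalize HP. intros [HL _]. assert (HJ : 0 < J) by apply HL.
  assert (HN : 0 < N).
  { unfold N. rewrite !(Rad_radicand J m psi) by exact HP.
    repeat apply Rmult_lt_0_compat; apply sqrt_lt_R0, radicand_pos. }
  assert (HN2 : N * N = gamma_speed J m psi t ^ 2 / 4 + J ^ 2).
  { rewrite (gamma_energy J m psi t HL). unfold N.
    rewrite !(Rad_radicand J m psi) by exact HP.
    assert (H : forall j, sqrt (radicand m psi j t) * sqrt (radicand m psi j t) =
      radicand m psi j t) by (intros; apply sqrt_sqrt; left; apply radicand_pos).
    transitivity (radicand m psi i1 t * radicand m psi i2 t * radicand m psi i3 t).
    - generalize (H i1) (H i2) (H i3). intros E1 E2 E3.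
      etransitivity; [| exact (f_equal2 Rmult (f_equal2 Rmult E1 E2) E3)]. ring.
    - reflexivity. }
  unfold sigma. rewrite (angle_sum theta J m psi t HP).
  set (v := gamma_speed J m psi t) in *. set (x := v / (2 * J)).
  assert (Hcos : 0 < cos (atan x)).
  { generalize (atan_bound x). intros. apply cos_gt_0; lra. }
  assert (Hsin : sin (atan x) = x * cos (atan x)).
  { rewrite <- (tan_atan x) at 2. unfold tan. field. lra. }
  assert (Hsq : cos (atan x) * cos (atan x) * (1 + x * x) = 1).
  { generalize (sin2_cos2 (atan x)). unfold Rsqr. rewrite Hsin. intros H.
    etransitivity; [| exact H]. ring. }
  assert (HC : N * cos (atan x) = J).
  { apply Rsqr_inj; [| lra |].
    - apply Rmult_le_pos; lra.
    - unfold Rsqr.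
      transitivity (J * J * (cos (atan x) * cos (atan x) * (1 + x * x)));
        [| rewrite Hsq; ring].
      transitivity (N * N * (cos (atan x) * cos (atan x))); [ring |].
      rewrite HN2. unfold x. field. lra. }
  split; [exact HC |].
  rewrite Hsin. transitivity (x * (N * cos (atan x))); [ring |].
  rewrite HC. unfold x. field. lra.
Qed.

Lemma is_derive_polar (r a : R -> R) (t r' a' : R) :
  is_derive r t r' -> is_derive a t a' ->
  is_derive (fun t => r t * cos (a t)) t (r' * cos (a t) - r t * a' * sin (a t)) /\
  is_derive (fun t => r t * sin (a t)) t (r' * sin (a t) + r t * a' * cos (a t)).
Proof.
  intros Hr Ha.
  assert (Er : Derive (fun x => r x) t = r') by apply is_derive_unique, Hr.
  assert (Ea : Derive (fun x => a x) t = a') by apply is_derive_unique, Ha.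
  split; auto_derive; try (split; [eexists; apply Hr |]; split; [eexists; apply Ha | trivial]);
    rewrite Er, Ea; ring.
Qed.

Lemma polar_dt_field (alpha phi : R) (r a : idx -> R) (v : C3) (j : idx) :
  (forall j, v j = Cmult (RtoC (r j)) (cis (a j))) ->
  dt_field alpha (cis phi) v j =
  Cmult (RtoC (mu alpha j * (r (next j) * r (next (next j)))))
    (cis (phi - (a (next j) + a (next (next j))))).
Proof.
  intros Hv. unfold dt_field. rewrite !Hv.
  unfold cis. rewrite cos_minus, sin_minus, cos_plus, sin_plus.
  unfold Cmult, RtoC, Re, Im; simpl. f_equal; ring.
Qed.

(** The polar equations say [z_j' / z_j = mu_j (gamma' / 2 + i J) / R_j^2]. The numerator is [i]
    times the conjugate of [e^{i theta} z_1 z_2 z_3], which produces the unit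
    [w = i e^{-i theta}]. *)
Lemma special_curve_zJ (theta J m : R) (psi : R -> R) : parametrises J m psi ->
  special_curve 0 (cis (PI / 2 - theta)) (zJ theta 0 J).
Proof.
  intros HP. split; [| split].
  - simpl. generalize (sin2_cos2 (PI / 2 - theta)). unfold Rsqr. lra.
  - intros j t.
    rewrite (polar_dt_field 0 _ (fun j => Rad 0 J j t) (fun j => angle theta 0 J j t))
      by reflexivity.
    assert (HR : forall j, 0 < Rad 0 J j t).
    { intros k. rewrite (Rad_radicand J m psi) by exact HP. apply sqrt_lt_R0, radicand_pos. }
    assert (HR2 : radicand m psi j t = Rad 0 J j t * Rad 0 J j t).
    { rewrite (Rad_radicand J m psi) by exact HP. symmetry. apply sqrt_sqrt.
      left. apply radicand_pos. }
    assert (Hr : is_derive (Rad 0 J j) t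
      (mu 0 j * gamma_speed J m psi t / (2 * Rad 0 J j t))).
    { rewrite (Rad_radicand J m psi) by exact HP.
      apply is_derive_ext with (fun t => sqrt (radicand m psi j t)).
      { intros x. symmetry. apply Rad_radicand, HP. }
      apply is_derive_sqrt; [apply is_derive_radicand, HP | apply radicand_pos]. }
    assert (Ha := is_derive_angle theta J m psi j t HP). rewrite HR2 in Ha.
    destruct (is_derive_polar _ _ _ _ _ Hr Ha) as [D1 D2].
    destruct (radii_product theta J m psi t HP) as [N1 N2].
    set (sigma := sum3 (fun j => angle theta 0 J j t) + theta) in *.
    set (N := Rad 0 J i1 t * Rad 0 J i2 t * Rad 0 J i3 t) in *.
    replace (PI / 2 - theta - (angle theta 0 J (next j) t + angle theta 0 J (next (next j)) t))
      with (PI / 2 - (sigma - angle theta 0 J j t)).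
    2:{ unfold sigma, sum3. destruct j; simpl; ring. }
    assert (HN : Rad 0 J (next j) t * Rad 0 J (next (next j)) t = N / Rad 0 J j t).
    { generalize (HR j). intros. unfold N. destruct j; simpl next; field; lra. }
    rewrite HN. generalize (HR j). intros HRj.
    unfold cis. rewrite cos_shift, sin_shift, cos_minus, sin_minus.
    split.
    + apply is_derive_ext with (fun t => Rad 0 J j t * cos (angle theta 0 J j t)).
      { intros x. unfold zJ, cis, Cmult, RtoC, Re; simpl. ring. }
      evar_last; [exact D1 |]. unfold Cmult, RtoC, Re; simpl.
      transitivity (mu 0 j / Rad 0 J j t * ((N * sin sigma) * cos (angle theta 0 J j t)
        - (N * cos sigma) * sin (angle theta 0 J j t)));
        [rewrite N1, N2 |]; field; lra.
    + apply is_derive_ext with (fun t => Rad 0 J j t * sin (angle theta 0 J j t)).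
      { intros x. unfold zJ, cis, Cmult, RtoC, Im; simpl. ring. }
      evar_last; [exact D2 |]. unfold Cmult, RtoC, Im; simpl.
      transitivity (mu 0 j / Rad 0 J j t * ((N * sin sigma) * sin (angle theta 0 J j t)
        + (N * cos sigma) * cos (angle theta 0 J j t)));
        [rewrite N1, N2 |]; field; lra.
  - intros t.
    assert (Hsq : forall j, sqmod (zJ theta 0 J t) j = radicand m psi j t).
    { intros j. transitivity (Rad 0 J j t * Rad 0 J j t *
        ((sin (angle theta 0 J j t))² + (cos (angle theta 0 J j t))²)).
      - unfold sqmod, zJ, cis, Cmult, RtoC, Re, Im, Rsqr; simpl. ring.
      - rewrite sin2_cos2, (Rad_radicand J m psi) by exact HP.
        rewrite sqrt_sqrt by (left; apply radicand_pos). ring. }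
    assert (B1 := radicand_pos m psi i1 t). assert (B3 := radicand_pos m psi i3 t).
    unfold admissible, sum3. rewrite !Hsq. unfold radicand in *. simpl in *.
    split; [| split]; [field | field | lra].
Qed.

(** * Closing the surface for [alpha = 0] *)

Lemma angle_i2 (theta J m : R) (psi : R -> R) (t : R) : parametrises J m psi ->
  angle theta 0 J i2 t = RInt (angle_density m) (PI / 2) (psi t).
Proof.
  intros HP. generalize HP. intros [HL [H0 Hpsi]]. assert (HJ : 0 < J) by apply HL.
  apply (is_derive_eq_const (angle theta 0 J i2)
    (fun t => RInt (angle_density m) (PI / 2) (psi t))
    (fun t => J * mu 0 i2 / radicand m psi i2 t) 0).
  - intros x. apply is_derive_angle, HP.
  - intros x. evar_last.
    + apply (is_derive_comp (fun b => RInt (angle_density m) (PI / 2) b) psi);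
        [| apply Hpsi].
      apply continuous_is_derive_RInt, continuous_angle_density.
    (* The second radicand is [profile] itself and [mu 0 i2 = 2], so the rate [2 J / profile] is
       [angle_density] divided by [time_density]. *)
    + unfold scal; simpl; unfold mult; simpl. unfold radicand, gamma_sol, time_density.
      assert (Hk : 0 < angle_density m (psi x)).
      { unfold angle_density. generalize (cos_beta_gt_half m (psi x))
          (profile_bounds m (psi x)). intros. apply Rmult_lt_0_compat; lra. }
      generalize (profile_bounds m (psi x)). intros Hy. simpl. field.
      repeat split; lra.
  - rewrite angle_0, H0. symmetry. apply (RInt_point (V := R_CompleteNormedModule)).
Qed.

(** At [alpha = 0] one has [mu_1 = mu_3], so both angles solve the same equation. Together with
    [angle_sum] this recovers them from the second angle. *)
Lemma angle_i1_i3 (theta J m : R) (psi : R -> R) (t : R) : parametrises J m psi ->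
  angle theta 0 J i1 t = angle theta 0 J i3 t - theta.
Proof.
  intros HP.
  apply (is_derive_eq_const (angle theta 0 J i1) (fun t => angle theta 0 J i3 t - theta)
    (fun t => J * mu 0 i1 / radicand m psi i1 t) 0).
  - intros x. apply is_derive_angle, HP.
  - intros x. replace (J * mu 0 i1 / radicand m psi i1 x)
      with (minus (J * mu 0 i3 / radicand m psi i3 x) zero).
    + apply (is_derive_minus (V := R_NormedModule));
        [apply is_derive_angle, HP | apply (is_derive_const (V := R_NormedModule))].
    + unfold radicand, mu, minus, plus, opp, zero; simpl.
      replace (-1 - 2 * 0) with (0 - 1) by ring. ring.
  - rewrite !angle_0. ring.
Qed.

Lemma psi_shift_nat (psi : R -> R) (T : R) (n : nat) (t : R) :
  (forall t, psi (t + T) = psi t + 2 * PI) ->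
  psi (t + INR n * T) = psi t + INR n * (2 * PI).
Proof.
  intros H. induction n as [| n IH].
  - simpl. replace (t + 0 * T) with t by ring. ring.
  - rewrite S_INR. replace (t + (INR n + 1) * T) with (t + INR n * T + T) by ring.
    rewrite H, IH. ring.
Qed.

Lemma angle_density_integral_shift (m x : R) (n : nat) :
  RInt (angle_density m) (PI / 2) (x + INR n * (2 * PI)) =
  RInt (angle_density m) (PI / 2) x + INR n * rotation m.
Proof.
  set (K := (fun b => RInt (angle_density m) (PI / 2) b) : R -> R).
  assert (HK : forall x, is_derive K x (angle_density m x)).
  { intros y. apply continuous_is_derive_RInt, continuous_angle_density. }
  assert (Hex : forall a b, ex_RInt (angle_density m) a b).
  { intros a b. apply (ex_RInt_continuous (V := R_CompleteNormedModule)).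
    intros; apply continuous_angle_density. }
  assert (H : forall y, K (y + 2 * PI) = K y + rotation m).
  { intros y. rewrite (primitive_shift K (angle_density m) (2 * PI) 0 HK
      (angle_density_period m) y).
    assert (E : K 0 + RInt (angle_density m) 0 (0 + 2 * PI) = K (0 + 2 * PI))
      by (apply (RInt_Chasles (V := R_CompleteNormedModule)); apply Hex).
    rewrite rotation_total in E. lra. }
  change (K (x + INR n * (2 * PI)) = K x + INR n * rotation m).
  induction n as [| n IH].
  - simpl. replace (x + 0 * (2 * PI)) with x by ring. ring.
  - rewrite S_INR. replace (x + (INR n + 1) * (2 * PI))
      with (x + INR n * (2 * PI) + 2 * PI) by ring.
    rewrite H, IH. ring.
Qed.

Lemma u_J_pos (theta J s t : R) : 0 < J ->
  u theta 0 J s t = exp_A 0 s (zJ theta 0 J t).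
Proof.
  intros HJ. unfold u. destruct (Req_EM_T J 0) as [H | _]; [lra | reflexivity].
Qed.

Lemma torus_J_pos (theta J : R) : rational_rotation J ->
  exists L : R -> R -> Prop,
    doubly_periodic L (u theta 0 J) /\
    exists F : torus L -> C3,
      (forall s t, F (proj L s t) = u theta 0 J s t) /\
      minimal_legendrian_torus L F.
Proof.
  intros [m [p [q [HL Hrot]]]].
  destruct (parameter_exists J m HL) as [psi [T [HT [H0 [Hpsi Hshift]]]]].
  assert (HP : parametrises J m psi) by (split; [| split]; assumption).
  assert (HJ : 0 < J) by apply HL.
  assert (Hq : 0 < IZR (Zpos q)) by (apply IZR_lt; reflexivity).
  generalize PI_RGT_0; intros Hpi.
  (* The factor 2 absorbs the half rotation of the first and third angles: after [2 q] oscillations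
     the changes are [- p], [2 p] and [- p] full turns. *)
  set (n := (2 * Pos.to_nat q)%nat).
  assert (Hn : INR n = 2 * IZR (Zpos q)).
  { unfold n. rewrite mult_INR, (INR_IZR_INZ (Pos.to_nat q)), positive_nat_Z.
    replace (INR 2) with 2 by (simpl; ring). reflexivity. }
  apply (torus_of_periods _ (1 * (2 * PI)) (INR n * T)).
  - lra.
  - apply Rgt_not_eq, Rmult_lt_0_compat; [rewrite Hn |]; lra.
  - intros s t. rewrite !u_J_pos by exact HJ.
    apply exp_A_shift with 1%Z 0%Z; ring.
  - intros s t. rewrite !u_J_pos by exact HJ. f_equal.
    set (t' := t + INR n * T).
    assert (Hpsi' : psi t' = psi t + INR n * (2 * PI)) by (apply psi_shift_nat, Hshift).
    assert (Hcs : cos (psi t') = cos (psi t) /\ sin (psi t') = sin (psi t)).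
    { assert (H : cis (psi t') = cis (psi t)).
      { rewrite Hpsi', INR_IZR_INZ. apply cis_shift. }
      injection H. auto. }
    destruct Hcs as [Hc Hs].
    assert (Hg : gamma_sol m psi t' = gamma_sol m psi t).
    { unfold gamma_sol, profile, beta, chi. rewrite Hs. reflexivity. }
    assert (Hv : gamma_speed J m psi t' = gamma_speed J m psi t).
    { unfold gamma_speed, chi. rewrite Hs, Hc. reflexivity. }
    assert (HR : forall j, Rad 0 J j t' = Rad 0 J j t).
    { intros j. rewrite !(Rad_radicand J m psi) by exact HP.
      unfold radicand. rewrite Hg. reflexivity. }
    assert (A2 : angle theta 0 J i2 t' = angle theta 0 J i2 t + IZR (2 * p) * (2 * PI)).
    { rewrite !(angle_i2 theta J m psi) by exact HP.
      rewrite Hpsi', angle_density_integral_shift, Hrot, Hn, mult_IZR.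
      field. lra. }
    (* The sum returns exactly, being the arctangent of a periodic quantity up to the constant
       [theta]; halving the change of the second angle is therefore unambiguous. *)
    assert (Hsum : sum3 (fun j => angle theta 0 J j t') = sum3 (fun j => angle theta 0 J j t)).
    { apply Rplus_eq_reg_r with theta. rewrite !(angle_sum theta J m psi) by exact HP.
      rewrite Hv. reflexivity. }
    unfold sum3 in Hsum.
    assert (B := angle_i1_i3 theta J m psi t HP).
    assert (B' := angle_i1_i3 theta J m psi t' HP).
    rewrite mult_IZR in A2.
    assert (Hcis : forall j, cis (angle theta 0 J j t') = cis (angle theta 0 J j t)).
    { intros [].
      - rewrite <- (cis_shift (angle theta 0 J i1 t) (- p)). f_equal. rewrite opp_IZR. lra.
      - rewrite <- (cis_shift (angle theta 0 J i2 t) (2 * p)). f_equal. rewrite mult_IZR. lra.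
      - rewrite <- (cis_shift (angle theta 0 J i3 t) (- p)). f_equal. rewrite opp_IZR. lra. }
    apply functional_extensionality; intros j. unfold zJ. rewrite HR, Hcis. reflexivity.
  - replace (u theta 0 J) with (fun s t => exp_A 0 s (zJ theta 0 J t)).
    + eapply special_minimal_legendrian, special_curve_surface, special_curve_zJ, HP.
    + apply functional_extensionality; intros s.
      apply functional_extensionality; intros t. symmetry. apply u_J_pos, HJ.
Qed.

Theorem theorem5 (theta : R) (Htheta : 0 <= theta < 2 * PI) :
  (forall alpha : R, (exists q : Q, alpha = Q2R q) -> 0 < alpha <= 1 ->
     exists L : R -> R -> Prop,
       doubly_periodic L (u theta alpha 0) /\
       exists F : torus L -> C3,
         (forall s t, F (proj L s t) = u theta alpha 0 s t) /\
         minimal_legendrian_torus L F) /\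
  (exists D : R -> Prop,
     dense_in D 0 (1 / (3 * sqrt 3)) /\
     forall J : R, D J ->
       exists L : R -> R -> Prop,
         doubly_periodic L (u theta 0 J) /\
         exists F : torus L -> C3,
           (forall s t, F (proj L s t) = u theta 0 J s t) /\
           minimal_legendrian_torus L F).
Proof.
  split.
  - intros alpha. apply torus_J0.
  - exists rational_rotation. split.
    + exact rational_rotation_dense.
    + intros J. apply torus_J_pos.
Qed.
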